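(* For every $K\ge2$, $$\nu\big(F_{2K+1}(\tau_{2K+1})\big)\ge 2K+3,$$ and for every $M\ge1$, $$\nu\big(F_{2K+1}(\tau_{2K+1}+M)\big)\ge 2K+M+2.$$
   Context: Let $E(q)=\prod_{m\ge1}(1-q^m)$. $PDO(n)$ is the number of partitions of $n$ into odd parts with designated summands (for each distinct part size, exactly one occurrence is designated); $\sum_{n\ge0}PDO(n)q^n=\frac{E(q^4)E(q^6)^2}{E(q)E(q^3)E(q^{12})}$. Define $$\gamma(q)=\frac{E(q)^5E(q^2)^5E(q^6)^5}{E(q^3)^{15}},\quad \xi=\xi(q)=\frac{E(q^2)^5E(q^6)}{E(q)E(q^3)^5},$$ and for $k\ge3$, $\Phi_k=\gamma(q)^{2^k}\left(\sum_{n\ge0}PDO(2^{k+2}n)q^n-\sum_{n\ge0}PDO(2^kn)q^n\right)$. It is known that $\Phi_k$ equals (as a formal power series in $q$) a polynomial in $\xi$ with integer coefficients; $F_k(m)$ denote these coefficients, $\Phi_k=\sum_m F_k(m)\xi^m$. For $K\ge2$, $\tau_{2K+1}=7\cdot 2^{2K-1}-\tfrac23\left(4^{K-1}-1\right)$. $\nu(n)$ is the $2$-adic valuation of an integer $n$ (largest $\alpha\ge0$ with $2^\alpha\mid n$), with $\nu(0)=\infty$. *)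

(* Defs.v *)
From HB Require Import structures.
From mathcomp Require Import all_boot all_order all_algebra.
Set Implicit Arguments. Unset Strict Implicit. Unset Printing Implicit Defensive.
Import Order.TTheory GRing.Theory Num.Theory.
Local Open Scope ring_scope.

(* Formal power series in q with integer coefficients, given by their
   coefficient sequence: s n is the coefficient of q^n. *)
Definition series := nat -> int.

Definition sone : series := fun n => if n == 0%N then 1 else 0.
Definition sadd (f g : series) : series := fun n => f n + g n.
Definition ssub (f g : series) : series := fun n => f n - g n.
Definition smul (f g : series) : series :=
  fun n => \sum_(i < n.+1) f i * g (n - i)%N.
Definition spow (f : series) (k : nat) : series := iter k (smul f) sone.
(* Inverse of a series f with constant term 1:
   1/f = sum_k (1 - f)^k, and (1-f)^k has valuation >= k. *)
Definition sinv (f : series) : series :=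
  fun n => \sum_(k < n.+1) spow (ssub sone f) k n.
Definition sdiv (f g : series) : series := smul f (sinv g).

(* E(q^j) = prod_{m >= 1} (1 - q^(j m)); its q^n coefficient only depends
   on the factors with m <= n (for j >= 1). *)
Definition Eq (j : nat) : series :=
  fun n => (\prod_(1 <= m < n.+1) (1 - 'X^(j * m) : {poly int}))`_n.

Definition PDOgf : series :=
  sdiv (smul (Eq 4) (spow (Eq 6) 2)) (smul (Eq 1) (smul (Eq 3) (Eq 12))).
Definition PDO (n : nat) : int := PDOgf n.

Definition gamma : series :=
  sdiv (smul (spow (Eq 1) 5) (smul (spow (Eq 2) 5) (spow (Eq 6) 5)))
       (spow (Eq 3) 15).
Definition xi : series :=
  sdiv (smul (spow (Eq 2) 5) (Eq 6)) (smul (Eq 1) (spow (Eq 3) 5)).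

Definition Phi (k : nat) : series :=
  smul (spow gamma (2 ^ k))
       (fun n => PDO (2 ^ (k + 2) * n) - PDO (2 ^ k * n)).

Definition poly_at_xi (P : {poly int}) : series :=
  fun n => \sum_(m < size P) P`_m * spow xi m n.

(* tau_{2K+1} = 7 * 2^(2K-1) - (2/3)(4^(K-1) - 1)  (exact division, K >= 2) *)
Definition tau (K : nat) : nat :=
  (7 * 2 ^ (2 * K - 1) - (2 * (4 ^ (K - 1) - 1)) %/ 3)%N.

(* nu(a) >= e, where nu is the 2-adic valuation with nu(0) = infinity *)
Definition nu_ge (a : int) (e : nat) : Prop := ((2 ^ e)%:Z %| a)%Z.

(* Main.v *)
(* Everything lives on a genus 0 curve with a uniformizer D that is an eta quotient:
   with theta functions phi and psi, the factorization phi(q) = phi(q^4) + 2 q psi(q^8)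
   (Jacobi triple product) and the substitution q -> q^2, which doubles orders of
   vanishing, force the cubic modular equation, hence D + 1, D - 1 and 2 D - 1 are eta
   quotients too.  Then 2 xi = (1 + D)(2 D - 1) / D^2, q -> -q maps D to 1 / D, and
   4 xi(q^2) = 2 + D + 1 / D.

   Since gamma(q^2)^2 / gamma(q) = sigma^5 with 2 sigma = 1 + D, extracting the even part
   gives Phi_{k+1} = U (sigma^(5 2^k) Phi_k), a half trace for D -> 1 / D.  Such a trace
   maps xi^t (xi - 1) Z[2 xi] into xi^t' (xi - 1) Z[4 xi] when k is odd, and
   xi^t (xi - 1) Z[4 xi] into 4 xi^t' (xi - 1) Z[2 xi] when k is even; the factor 4 uses
   that Z[D, 1/D] modulo 2 and 4 xi(q^2) is the group algebra of a group of order 2.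
   Starting from Phi_3 in 2^5 xi^14 (xi - 1) Z[2 xi] this gives
   Phi_{2K+1} in 2^(2K+3) xi^tau (xi - 1) Z[2 xi], which is the theorem. *)
From HB Require Import structures.
Require Import Defs.
From mathcomp Require Import all_boot all_order all_algebra.
From mathcomp.classical Require Import boolp.
From mathcomp Require Import ring zify.
Set Implicit Arguments.
Unset Strict Implicit.
Unset Printing Implicit Defensive.
Import GRing.Theory.
Local Open Scope ring_scope.

(** The accounting of powers of 2, with [y = 4 xi(q^2)]: writing [xi - 1] through [D] costs a factor
    2, the half trace costs another 2, and the trace returns [y - 4 = 4 (xi(q^2) - 1)]. Only even
    powers of [sig] are powers of [xi(q^2)] up to a power of [D], and the total power of [sig] has
    the parity of the exponent of [xi], which alternates. For an even exponent the costs and gains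
    balance. For an odd one a single [sig = (1 + D) / 2] is left over; it turns [D - 1] into
    [D^2 - 1], whose traces are divisible by [y (y - 4)], so that 2 is lost and 4 is gained. The
    second factor 2 is the evenness of one constant coefficient; it depends on the parity of a power
    of [D], and it is also what brings the variable [4 xi] back to [2 xi]. The obstacle is that
    every identity concerns formal series. Modular equations therefore come from functional
    equations of their defects under [q -> q^2], and the choice of a root or of a factor is settled
    by the constant term or the coefficient of [q]. *)

(** * The integral domain of power series *)

Definition fps : Type := series.

HB.instance Definition _ := gen_eqMixin fps.
HB.instance Definition _ := gen_choiceMixin fps.

(** A coefficient of a product only sees truncations of the factors, so the ring laws of series are
    inherited from [{poly int}]. *)
Definition trunc (N : nat) (f : series) : {poly int} := \poly_(i < N) f i.

Lemma coef_trunc N f i : (i < N)%N -> (trunc N f)`_i = f i.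
Proof. by move=> ltiN; rewrite coef_poly ltiN. Qed.

Lemma smul_trunc N (f g : series) n :
  (n < N)%N -> smul f g n = (trunc N f * trunc N g)`_n.
Proof.
move=> ltnN; rewrite coefM; apply: eq_bigr => i _.
by have ltin := ltn_ord i; rewrite !coef_trunc //; lia.
Qed.

Lemma coefM_eq (p p' r r' : {poly int}) n :
  (forall i, (i <= n)%N -> p`_i = p'`_i) ->
  (forall i, (i <= n)%N -> r`_i = r'`_i) -> (p * r)`_n = (p' * r')`_n.
Proof.
move=> eqp eqr; rewrite !coefM; apply: eq_bigr => i _.
by have ltin := ltn_ord i; rewrite eqp ?eqr //; lia.
Qed.

Lemma smulC : commutative smul.
Proof.
by move=> f g; apply: funext => n; rewrite !(@smul_trunc n.+1) // mulrC.
Qed.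

Lemma smulA : associative smul.
Proof.
move=> f g h; apply: funext => n; rewrite !(@smul_trunc n.+1) //.
have coefs (u v : series) i : (i <= n)%N ->
    (trunc n.+1 (smul u v))`_i = (trunc n.+1 u * trunc n.+1 v)`_i.
  by move=> lein; rewrite coef_trunc // (@smul_trunc n.+1).
rewrite (@coefM_eq _ (trunc n.+1 f) _ (trunc n.+1 g * trunc n.+1 h)) //; last exact: coefs.
rewrite [RHS](@coefM_eq _ (trunc n.+1 f * trunc n.+1 g) _ (trunc n.+1 h)) //.
  by rewrite mulrA.
exact: coefs.
Qed.

Lemma smul1 : left_id sone smul.
Proof.
move=> f; apply: funext => n; rewrite /smul big_ord_recl /= /sone eqxx mul1r subn0.
by rewrite big1 ?addr0 // => i _; rewrite mul0r.
Qed.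

Lemma smulDl : left_distributive smul sadd.
Proof.
move=> f g h; apply: funext => n; rewrite /smul /sadd -big_split /=.
by apply: eq_bigr => i _; rewrite mulrDl.
Qed.

Definition szero : series := fun=> 0.
Definition sopp (f : series) : series := fun n => - f n.

Lemma saddA : associative sadd.
Proof. by move=> f g h; apply: funext => n; rewrite /sadd addrA. Qed.
Lemma saddC : commutative sadd.
Proof. by move=> f g; apply: funext => n; rewrite /sadd addrC. Qed.
Lemma sadd0 : left_id szero sadd.
Proof. by move=> f; apply: funext => n; rewrite /sadd add0r. Qed.
Lemma saddN : left_inverse szero sopp sadd.
Proof. by move=> f; apply: funext => n; rewrite /sadd addNr. Qed.

HB.instance Definition _ := GRing.isZmodule.Build fps saddA saddC sadd0 saddN.

Lemma sone_neq0 : (sone : fps) != 0.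
Proof. by apply/eqP => /(congr1 (fun f : series => f 0%N)). Qed.

HB.instance Definition _ :=
  GRing.Zmodule_isComNzRing.Build fps smulA smulC smul1 smulDl sone_neq0.

Lemma fpsD (f g : fps) n : (f + g) n = f n + g n. Proof. by []. Qed.
Lemma fpsN (f : fps) n : (- f) n = - f n. Proof. by []. Qed.
Lemma fpsB (f g : fps) n : (f - g) n = f n - g n. Proof. by []. Qed.
Lemma fps0 n : (0 : fps) n = 0. Proof. by []. Qed.
Lemma fps1 n : (1 : fps) n = (n == 0%N)%:R. Proof. by case: n. Qed.
Lemma fpsM (f g : fps) n : (f * g) n = \sum_(i < n.+1) f i * g (n - i)%N.
Proof. by []. Qed.
Lemma fpsM0 (f g : fps) : (f * g) 0%N = f 0%N * g 0%N.
Proof. by rewrite fpsM big_ord1. Qed.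
Lemma fpsM1 (f g : fps) : (f * g) 1%N = f 0%N * g 1%N + f 1%N * g 0%N.
Proof. by rewrite fpsM !big_ord_recl big_ord0 addr0. Qed.
Lemma fps_sum I (r : seq I) (P : pred I) (F : I -> fps) n :
  (\sum_(i <- r | P i) F i) n = \sum_(i <- r | P i) F i n.
Proof. exact: (big_morph (fun f : fps => f n) (fun f g => fpsD f g n) (fps0 n)). Qed.
Lemma fpsMn (f : fps) k n : (f *+ k) n = f n *+ k.
Proof. by elim: k => // k IHk; rewrite !mulrS fpsD IHk. Qed.
Lemma fps_eqP (f g : fps) : (forall n, f n = g n) -> f = g.
Proof. exact: funext. Qed.
Lemma spowE (f : fps) k : spow f k = f ^+ k.
Proof. by elim: k => // k IHk; rewrite exprS -IHk. Qed.

(** * Order of vanishing *)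

Definition vanish (n : nat) (f : fps) := forall i, (i < n)%N -> f i = 0.

Lemma vanishW m n f : (m <= n)%N -> vanish n f -> vanish m f.
Proof. by move=> lemn fn i ltim; apply: fn; apply: leq_trans lemn. Qed.
Lemma vanishD n f g : vanish n f -> vanish n g -> vanish n (f + g).
Proof. by move=> fn gn i ltin; rewrite fpsD fn ?gn ?addr0. Qed.
Lemma vanishN n f : vanish n f -> vanish n (- f).
Proof. by move=> fn i ltin; rewrite fpsN fn ?oppr0. Qed.
Lemma vanishB n f g : vanish n f -> vanish n g -> vanish n (f - g).
Proof. by move=> fn gn; apply/vanishD/vanishN. Qed.
Lemma vanishM m n f g : vanish m f -> vanish n g -> vanish (m + n) (f * g).
Proof.
move=> fm gn i ltimn; rewrite fpsM big1 // => j _.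
have [/fm->|lemj] := ltnP j m; first by rewrite mul0r.
by have ltji := ltn_ord j; rewrite gn ?mulr0 //; lia.
Qed.
Lemma vanishMr n f g : vanish n f -> vanish n (f * g).
Proof. by move=> fn; rewrite -[n]addn0; apply: vanishM. Qed.
Lemma vanishMl n f g : vanish n g -> vanish n (f * g).
Proof. by rewrite mulrC; apply: vanishMr. Qed.
Lemma vanishX (f : fps) n : f 0%N = 0 -> vanish n (f ^+ n).
Proof.
move=> f0; elim: n => // n IHn; rewrite exprS -add1n; apply: vanishM => //.
by case.
Qed.
Lemma vanish_sum I (r : seq I) (P : pred I) (F : I -> fps) n :
  (forall i, P i -> vanish n (F i)) -> vanish n (\sum_(i <- r | P i) F i).
Proof.
move=> Fn; apply: (big_ind (vanish n)) => //; exact: vanishD.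
Qed.
Lemma vanish_eq0 f : (forall n, vanish n f) -> f = 0.
Proof. by move=> fn; apply: fps_eqP => n; apply: (fn n.+1). Qed.
Lemma vanish_cancel m n f g :
  vanish m g -> g m != 0 -> vanish (m + n) (f * g) -> vanish n f.
Proof.
move=> gm gm0 fg; elim/ltn_ind => i IHi ltin.
have := fg (m + i)%N; rewrite ltn_add2l => /(_ ltin).
rewrite fpsM (bigD1 (inord i)) //= inordK ?addnK; last by lia.
rewrite big1 ?addr0 => [/eqP|j].
  by rewrite mulf_eq0 (negPf gm0) orbF => /eqP.
rewrite -val_eqE /= inordK; last by lia.
have [ltji _|ltij _|//] := ltngtP j i.
  by rewrite IHi ?mul0r //; lia.
by rewrite gm ?mulr0 //; have := ltn_ord j; lia.
Qed.

Lemma fps_order (f : fps) : f != 0 -> exists2 m, vanish m f & f m != 0.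
Proof.
move=> f0; have /existsNP[n /eqP fn] : ~ forall n, f n = 0.
  by move=> fn; case/eqP: f0; apply: fps_eqP.
have exf : exists n, f n != 0 by exists n.
case: (ex_minnP exf) => m fm minm; exists m => // i ltim.
by apply/eqP; case: eqP => // /eqP/minm; rewrite leqNgt ltim.
Qed.

Lemma sinvK (g : fps) : g 0%N = 1 -> (sinv g : fps) * g = 1.
Proof.
move=> g0; apply: fps_eqP => n.
pose u : fps := 1 - g; have u0 : u 0%N = 0 by rewrite /u fpsB g0.
have -> : ((sinv g : fps) * g) n =
 ((\sum_(k < n.+1) u ^+ k) * g) n.
  rewrite !fpsM; apply: eq_bigr => -[i ltin] _ /=; congr (_ * _).
  (* The geometric sum defining coefficient [i] may be extended to [n.+1] terms, since [u ^+ k]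
     vanishes to order [k]; the extended sum no longer depends on [i], and it telescopes. *)
  rewrite fps_sum /sinv (big_ord_widen n.+1 (fun k => spow (ssub sone g) k i)) //.
  rewrite [RHS](bigID (fun k : 'I__ => (k < i.+1)%N)) /= [X in _ + X]big1 ?addr0.
    by apply: eq_bigr => k _; rewrite spowE.
  by move=> k; rewrite -leqNgt => ltik; rewrite vanishX.
have -> : g = 1 - u by rewrite /u opprB addrC subrK.
rewrite mulrC.
have -> : (1 - u) * \sum_(k < n.+1) u ^+ k = 1 - u ^+ n.+1.
  by rewrite -[1 - u]opprB mulNr -subrX1 opprB.
have -> // : (1 - u ^+ n.+1) n = (1 : fps) n.
by rewrite fpsB (@vanishX u n.+1) // subr0.
Qed.

Lemma fpsMz (c : int) (f : fps) n : (c%:~R * f) n = c * f n.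
Proof.
rewrite mulrzl; case: c => k; first by rewrite -pmulrn fpsMn -mulr_natl natz.
by rewrite NegzE mulrNz -pmulrn fpsN fpsMn mulNr -mulr_natl natz.
Qed.

Definition fps_unit : pred fps := [pred f : fps | f 0%N \is a GRing.unit].
(* A unit constant term is [1] or [-1], hence its own inverse. *)
Definition fps_inv (f : fps) : fps :=
  if fps_unit f then (f 0%N)%:~R * (sinv ((f 0%N)%:~R * f) : fps) else f.

Lemma fps_mulVx : {in fps_unit, left_inverse 1 fps_inv *%R}.
Proof.
move=> f f0; rewrite /fps_inv ifT //.
rewrite -mulrA mulrCA sinvK // fpsMz.
by move: f0; rewrite inE /=; case: (f 0%N) => [[|[|n]]|[|n]].
Qed.

Lemma fps_unitPl (f g : fps) : g * f = 1 -> fps_unit f.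
Proof.
move=> gf1; apply/unitrPr; exists (g 0%N).
by rewrite mulrC -fpsM0 gf1.
Qed.

Lemma fps_inv_out : {in [predC fps_unit], fps_inv =1 id}.
Proof. by move=> f fu; rewrite /fps_inv ifF //; exact: negbTE.
 Qed.

HB.instance Definition _ :=
  GRing.ComNzRing_hasMulInverse.Build fps fps_mulVx fps_unitPl fps_inv_out.

Lemma fps_unitE (f : fps) : (f \is a GRing.unit) = (f 0%N \is a GRing.unit).
Proof. by []. Qed.

Lemma fps_mulf_eq0 (f g : fps) : f * g = 0 -> (f == 0) || (g == 0).
Proof.
move=> fg0; case: eqP => // /eqP f0; case: eqP => //= g0; case/eqP: f0.
have [m gm gm0] := fps_order (introN eqP g0).
apply: vanish_eq0 => n; apply: (@vanish_cancel m n f g) => //.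
by rewrite fg0.
Qed.

HB.instance Definition _ :=
  GRing.ComUnitRing_isIntegral.Build fps fps_mulf_eq0.

Lemma sinvE (f : fps) : f 0%N = 1 -> (sinv f : fps) = f^-1.
Proof.
move=> f0; have fu : f \is a GRing.unit by rewrite fps_unitE f0.
by apply: (mulIr fu); rewrite sinvK // mulVr.
Qed.



(** With the arguments 1 and 3 this is the cancellation of 2 and 4 used throughout. *)
Lemma fps_mulIn (k : nat) (f g : fps) : f *+ k.+1 = g *+ k.+1 -> f = g.
Proof.
move=> eqfg; apply: fps_eqP => n; move/(congr1 (fun h : fps => h n)): eqfg.
by rewrite !fpsMn -[LHS]mulr_natr -[RHS]mulr_natr; apply: mulIf; rewrite natz.
Qed.

Definition q : fps := fun n => (n == 1)%:R.

Lemma fps_qM (f : fps) n : (q * f) n.+1 = f n.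
Proof.
rewrite fpsM big_ord_recl big_ord_recl big1 ?addr0 /q /=.
  by rewrite mul0r add0r mul1r subn1.
by move=> i _; rewrite mul0r.
Qed.
Lemma fps_qM0 (f : fps) : (q * f) 0%N = 0.
Proof. by rewrite fpsM0 mul0r. Qed.

Lemma fps_qX k n : (q ^+ k) n = (n == k)%:R.
Proof.
elim: k n => [|k IHk] n; first by rewrite expr0 fps1.
by rewrite exprS; case: n => [|n]; rewrite ?fps_qM0 ?fps_qM.
Qed.

Lemma vanish_qX k : vanish k (q ^+ k).
Proof. by move=> i ltik; rewrite fps_qX; case: eqP => // eik; rewrite eik ltnn in ltik. Qed.

Definition fps_of_poly (p : {poly int}) : fps := fun n => p`_n.

Lemma fps_of_poly_zmod : zmod_morphism fps_of_poly.
Proof. by move=> p r; apply: fps_eqP => n; rewrite /fps_of_poly coefB. Qed.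
Lemma fps_of_poly_mon : monoid_morphism fps_of_poly.
Proof.
split=> [|p r]; apply: fps_eqP => n; rewrite /fps_of_poly.
  by rewrite coef1 fps1.
by rewrite coefM.
Qed.
HB.instance Definition _ :=
  GRing.isZmodMorphism.Build {poly int} fps fps_of_poly fps_of_poly_zmod.
HB.instance Definition _ :=
  GRing.isMonoidMorphism.Build {poly int} fps fps_of_poly fps_of_poly_mon.

Lemma fps_of_polyX : fps_of_poly 'X = q.
Proof. by apply: fps_eqP => n; rewrite /fps_of_poly coefX. Qed.

(** * The substitutions q -> q^d and q -> -q, and the operator U *)

Definition V (d : nat) (f : fps) : fps :=
  fun n => if (d %| n)%N then f (n %/ d)%N else 0.

Lemma V_trunc N d f n :
  (0 < d)%N -> (n < N)%N -> V d f n = (trunc N f \Po 'X^d)`_n.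
Proof.
move=> d0 ltnN; rewrite coef_comp_poly_Xn // /V; case: ifP => // _.
by rewrite coef_trunc //; apply: leq_ltn_trans (leq_div _ _) ltnN.
Qed.

Lemma fpsM_trunc N (f g : fps) n :
  (n < N)%N -> (f * g) n = (trunc N f * trunc N g)`_n.
Proof. exact: smul_trunc. Qed.

Lemma V_zmod d : zmod_morphism (V d.+1).
Proof.
by move=> f g; apply: fps_eqP => n; rewrite fpsB /V; case: ifP => // _; rewrite subrr.
Qed.

Lemma V_mon d : monoid_morphism (V d.+1).
Proof.
split=> [|f g]; apply: fps_eqP => n.
  rewrite /V !fps1; case: ifP => [/dvdnP[k ->]|]; first by rewrite mulnK // muln_eq0 orbF.
  by case: n.
rewrite (@V_trunc n.+1) // (@fpsM_trunc n.+1) //.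
rewrite [RHS](@coefM_eq _ (trunc n.+1 f \Po 'X^(d.+1)) _ (trunc n.+1 g \Po 'X^(d.+1))).
- rewrite -comp_polyM !coef_comp_poly_Xn //; case: ifP => // _.
  have le_n := leq_div n d.+1.
  by rewrite coef_trunc // -(@fpsM_trunc n.+1).

- by move=> i lein; rewrite coef_trunc // (@V_trunc n.+1).
- by move=> i lein; rewrite coef_trunc // (@V_trunc n.+1).
Qed.

HB.instance Definition _ d :=
  GRing.isZmodMorphism.Build fps fps (V d.+1) (V_zmod d).
HB.instance Definition _ d :=
  GRing.isMonoidMorphism.Build fps fps (V d.+1) (V_mon d).

Lemma V0 d f : V d f 0%N = f 0%N.
Proof. by rewrite /V dvdn0 div0n. Qed.

Lemma V_dvd d f n : (0 < d)%N -> V d f (d * n)%N = f n.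
Proof. by move=> d0; rewrite /V dvdn_mulr // mulKn. Qed.

Lemma V_V d e f : (0 < d)%N -> V d (V e f) = V (d * e) f.
Proof.
move=> d0; apply: fps_eqP => n; rewrite /V.
case: ifP => [/dvdnP[k ->]|]; first by rewrite mulnC mulKn // dvdn_pmul2l // divnMl.
by case: ifP => // /(dvdn_trans (dvdn_mulr e (dvdnn d))) ->.
Qed.

Lemma V_inj d f g : V d.+1 f = V d.+1 g -> f = g.
Proof.
by move=> eqV; apply: fps_eqP => n; rewrite -(@V_dvd d.+1 f) // eqV V_dvd.
Qed.

Lemma vanish_V d n f : (0 < d)%N -> vanish n f -> vanish (d * n) (V d f).
Proof.
move=> d0 fn i; rewrite /V; case: ifP => // /dvdnP[k ->].
by rewrite mulnC ltn_pmul2l // mulKn // => /fn.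
Qed.

Lemma V_q d : V d.+1 q = q ^+ d.+1.
Proof.
apply: fps_eqP => n; rewrite fps_qX /V /q; case: ifP => [/dvdnP[k ->]|].
  by rewrite mulnK // -[X in _ = (_ == X)%:R]mul1n eqn_pmul2r.
by case: eqP => // ->; rewrite dvdnn.
Qed.

(** A coefficient of positive index is either zero or equal to one of smaller index; the form [d.+2]
    excludes the identity substitution. *)
Lemma V_fix d f : V d.+2 f = f -> f = (f 0%N)%:~R.
Proof.
move=> Vf; apply: fps_eqP; elim/ltn_ind => n IHn.
have fz m : ((f 0%N)%:~R : fps) m = f 0%N * (m == 0%N)%:R by rewrite -[_%:~R]mulr1 fpsMz fps1.
rewrite -Vf /V; case: ifP => [/dvdnP[k nE]|].
  case: (posnP n) nE => [->|n0] nE.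
    by rewrite div0n fz mulr1.
  rewrite {1}nE mulnK // IHn; last by lia.
  by rewrite !fz; case: eqP; case: eqP; lia.
by rewrite fz; case: n {IHn} => // n _; rewrite mulr0.
Qed.

Definition sgn (f : fps) : fps := fun n => (-1) ^+ n * f n.

Lemma sgn_zmod : zmod_morphism sgn.
Proof. by move=> f g; apply: fps_eqP => n; rewrite /sgn !fpsB mulrBr. Qed.
Lemma sgn_mon : monoid_morphism sgn.
Proof.
split=> [|f g]; apply: fps_eqP => n; rewrite /sgn.
  by rewrite fps1; case: n => [|n]; rewrite ?mulr0 // mulr1.
rewrite !fpsM mulr_sumr; apply: eq_bigr => i _.
have -> : ((-1) ^+ n : int) = (-1) ^+ i * (-1) ^+ (n - i).
  by rewrite -exprD; congr (_ ^+ _); have := ltn_ord i; lia.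
by rewrite mulrACA.
Qed.
HB.instance Definition _ := GRing.isZmodMorphism.Build fps fps sgn sgn_zmod.
HB.instance Definition _ := GRing.isMonoidMorphism.Build fps fps sgn sgn_mon.

Lemma sgnK : involutive sgn.
Proof.
move=> f; apply: fps_eqP => n; rewrite /sgn mulrA -exprD addnn.
by rewrite -signr_odd odd_double mul1r.
Qed.
Lemma sgn_q : sgn q = - q.
Proof.
apply: fps_eqP => n; rewrite fpsN /sgn /q; case: eqP => [->|]; last by rewrite mulr0 oppr0.
by rewrite expr1 mulN1r.
Qed.
Lemma sgn_V2 f : sgn (V 2 f) = V 2 f.
Proof.
apply: fps_eqP => n; rewrite /sgn /V; case: ifP; last by rewrite mulr0.
by rewrite dvdn2 -signr_odd => /negPf ->; rewrite mul1r.
Qed.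
Lemma sgn_V3 f : sgn (V 3 f) = V 3 (sgn f).
Proof.
apply: fps_eqP => n; rewrite /sgn /V; case: ifP => [/dvdnP[k ->]|]; last by rewrite mulr0.
by rewrite mulnK // -signr_odd oddM andbT signr_odd.
Qed.

Definition U (f : fps) : fps := fun n => f (2 * n)%N.

Lemma V2_U f : V 2 (U f) *+ 2 = f + sgn f.
Proof.
apply: fps_eqP => n; rewrite fpsMn fpsD /V /U /sgn -signr_odd dvdn2.
case: (boolP (odd n)) => /= [_|]; first by rewrite mul0rn expr1 mulN1r subrr.
by rewrite -dvdn2 => /dvdnP[k ->]; rewrite mulnK // mul1r mulnC mulr2n.
Qed.

(** Reduces the computation of [U f] to a trace for [q -> -q], where the ring morphism [sgn] can be
    pushed through products. *)
Lemma U_eq f g : f + sgn f = V 2 g *+ 2 -> U f = g.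
Proof. by move=> fg; apply: (@V_inj 1); apply: (@fps_mulIn 1); rewrite V2_U. Qed.

Lemma U_V2M f g : U (V 2 f * g) = f * U g.
Proof. by apply: U_eq; rewrite !rmorphM /= sgn_V2 -mulrDr -V2_U mulrnAr. Qed.

(** * Euler products *)

(** Congruence modulo [q^n]. Identities of infinite products are proved for finite ones and passed
    to the limit by [eqmod_eq]. *)
Definition eqmod (n : nat) (f g : fps) := vanish n (f - g).

Lemma eqmod_refl n f : eqmod n f f.
Proof. by rewrite /eqmod subrr. Qed.
Lemma eqmod_sym n f g : eqmod n f g -> eqmod n g f.
Proof. by move=> fg; rewrite /eqmod -opprB; apply: vanishN. Qed.
Lemma eqmod_trans n g f h : eqmod n f g -> eqmod n g h -> eqmod n f h.
Proof.
by move=> fg gh; rewrite /eqmod -[f](subrK g) -addrA; apply: vanishD.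
Qed.
Lemma eqmodW m n f g : (m <= n)%N -> eqmod n f g -> eqmod m f g.
Proof. exact: vanishW. Qed.
Lemma eqmodD n f f' g g' : eqmod n f f' -> eqmod n g g' -> eqmod n (f + g) (f' + g').
Proof. by move=> ff' gg'; rewrite /eqmod opprD addrACA; apply: vanishD. Qed.
Lemma eqmodM n f f' g g' : eqmod n f f' -> eqmod n g g' -> eqmod n (f * g) (f' * g').
Proof.
move=> ff' gg'; rewrite /eqmod.
have -> : f * g - f' * g' = (f - f') * g + f' * (g - g') by ring.
by apply: vanishD; [apply: vanishMr | apply: vanishMl].
Qed.
Lemma eqmodX n f g k : eqmod n f g -> eqmod n (f ^+ k) (g ^+ k).
Proof.
move=> fg; elim: k => [|k IHk]; first exact: eqmod_refl.
by rewrite !exprS; apply: eqmodM.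
Qed.
Lemma eqmod_V d n f g : eqmod n f g -> eqmod n (V d.+1 f) (V d.+1 g).
Proof.
move=> fg; rewrite /eqmod -(rmorphB (V d.+1)).
by apply: (@vanishW _ (d.+1 * n)); [rewrite leq_pmull | apply: vanish_V].

Qed.
Lemma eqmod_sgn n f g : eqmod n f g -> eqmod n (sgn f) (sgn g).
Proof.
move=> fg; rewrite /eqmod -(rmorphB sgn) => i ltin.
by rewrite -[LHS]/((-1) ^+ i * (f - g) i) (fg i ltin) mulr0.
Qed.
Lemma eqmod_eq f g : (forall n, eqmod n f g) -> f = g.
Proof. by move=> fg; apply/eqP; rewrite -subr_eq0; apply/eqP/vanish_eq0. Qed.
Lemma eqmod_sum I (r : seq I) (P : pred I) (F G : I -> fps) n :
  (forall i, P i -> eqmod n (F i) (G i)) ->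
  eqmod n (\sum_(i <- r | P i) F i) (\sum_(i <- r | P i) G i).
Proof.
move=> FG; rewrite /eqmod -sumrB; exact: vanish_sum.
Qed.

Definition E (j : nat) : fps := Eq j.

Definition eprod (j N : nat) : fps := \prod_(1 <= m < N.+1) (1 - q ^+ (j * m)).

Lemma eprodS j N : eprod j N.+1 = eprod j N * (1 - q ^+ (j * N.+1)).
Proof. by rewrite /eprod big_nat_recr. Qed.
Lemma eprod0 j : eprod j 0 = 1.
Proof. by rewrite /eprod big_nil. Qed.

Lemma eprod_const j N : (0 < j)%N -> eprod j N 0%N = 1.
Proof.
move=> j0; elim: N => [|N IHN]; first by rewrite eprod0.
rewrite eprodS fpsM0 IHN mul1r fpsB fps_qX fps1 eqxx.
by case: eqP => [|_]; [lia | rewrite subr0].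
Qed.

Lemma eprod_stable j M N :
  (M <= N)%N -> eqmod (j * M.+1) (eprod j N) (eprod j M).
Proof.
elim: N => [|N IHN]; first by rewrite leqn0 => /eqP ->; apply: eqmod_refl.
rewrite leq_eqVlt => /orP[/eqP ->|]; first exact: eqmod_refl.
rewrite ltnS => leMN; apply: (eqmod_trans _ (IHN leMN)).
rewrite /eqmod eprodS mulrBr mulr1 addrAC subrr add0r.
apply/vanishN/vanishMl; apply: (vanishW _ (@vanish_qX _)).
by rewrite leq_mul2l ltnS leMN orbT.
Qed.

Lemma E_eprod j N : (0 < j)%N -> eqmod (j * N.+1) (E j) (eprod j N).
Proof.
move=> j0 i ltiN; rewrite fpsB /E /Eq.
have -> : (\prod_(1 <= m < i.+1) (1 - 'X^(j * m)) : {poly int})`_i = eprod j i i.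
  rewrite -[LHS]/(fps_of_poly _ i) rmorph_prod /eprod; congr ((_ : fps) i).
  by apply: eq_bigr => m _; rewrite rmorphB rmorph1 rmorphXn /= fps_of_polyX.
case: (leqP i N) => leiN.
  have lti : (i < j * i.+1)%N by nia.
  have := @eprod_stable j i N leiN i lti; rewrite fpsB => /eqP.
  by rewrite subr_eq0 => /eqP ->; rewrite subrr.
by rewrite -fpsB; apply: (@eprod_stable j N i (ltnW leiN)).
Qed.

Lemma E_eprodW j n N : (0 < j)%N -> (n <= N)%N -> eqmod n (E j) (eprod j N).
Proof.
by move=> j0 lenN; apply: (eqmodW _ (@E_eprod j N j0)); nia.
Qed.

Lemma E_const j : (0 < j)%N -> E j 0%N = 1.
Proof.
move=> j0; have := @E_eprodW j 1 1 j0 isT 0%N isT; rewrite fpsB eprod_const //.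
by move/eqP; rewrite subr_eq0 => /eqP.
Qed.

Lemma V_E d j : (0 < j)%N -> V d.+1 (E j) = E (d.+1 * j).
Proof.
move=> j0; apply: eqmod_eq => n.
apply: (eqmod_trans (eqmod_V d (E_eprodW j0 (leqnn n)))).
have -> : V d.+1 (eprod j n) = eprod (d.+1 * j) n.
  rewrite /eprod rmorph_prod; apply: eq_bigr => m _.
  by rewrite rmorphB rmorph1 rmorphXn /= V_q -exprM mulnA.
by apply/eqmod_sym/E_eprodW; rewrite // muln_gt0.
Qed.

(** In [E(q) E(-q)] the even factors appear squared and the odd ones pair up to [1 - q^(2m)];
    [E(q^4)] supplies the missing [1 - q^(2m)] with [m] even. *)
Lemma sgn_E1 : E 1 * sgn (E 1) * E 4 = E 2 ^+ 3.
Proof.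
have fin N : eprod 1 (2 * N) * sgn (eprod 1 (2 * N)) * eprod 4 N =
    eprod 2 N ^+ 2 * eprod 2 (2 * N).
  elim: N => [|N IHN]; first by rewrite muln0 !eprod0 rmorph1; ring.
  rewrite mulnS !eprodS !rmorphM !rmorphB !rmorph1 !rmorphXn /= sgn_q !mul1n.
  move: IHN; set e1 := eprod 1 _; set e1' := sgn e1; set e4 := eprod 4 _.
  set e2 := eprod 2 _; set e2' := eprod 2 _ => IHN.
  have -> : (- q) ^+ (2 * N).+1 = - q ^+ (2 * N).+1.
    by rewrite exprNn -signr_odd /= oddM /= mulN1r.
  have -> : (- q) ^+ (2 * N).+2 = q ^+ (2 * N).+2.
    by rewrite exprNn -signr_odd /= oddM /= mul1r.
  have -> : (2 * N.+1 = (2 * N).+2)%N by lia.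
  have -> : (2 * (2 * N).+1 = (2 * N).+1 * 2)%N by lia.
  have -> : (2 * (2 * N).+2 = (2 * N).+2 * 2)%N by lia.
  have -> : (4 * N.+1 = (2 * N).+2 * 2)%N by lia.
  rewrite !exprM; move: (q ^+ _) (q ^+ _) => z y.
  have -> : e1 * (1 - y) * (1 - z) * (e1' * (1 - (- y)) * (1 - z)) * (e4 * (1 - z ^+ 2))
    = (e1 * e1' * e4) * ((1 - y ^+ 2) * (1 - z) ^+ 2 * (1 - z ^+ 2)) by ring.
  by rewrite IHN; ring.
apply: eqmod_eq => n.
have En j : (0 < j)%N -> eqmod n (E j) (eprod j n) by move=> j0; apply: E_eprodW.
have E2n j : (0 < j)%N -> eqmod n (E j) (eprod j (2 * n)).
  by move=> j0; apply: E_eprodW => //; lia.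
apply: (@eqmod_trans _ (eprod 1 (2 * n) * sgn (eprod 1 (2 * n)) * eprod 4 n)).
  by apply: eqmodM; [apply: eqmodM; [|apply: eqmod_sgn]|]; auto.
rewrite fin [E 2 ^+ 3]exprSr; apply: eqmod_sym.
by apply: eqmodM; [apply: eqmodX|]; auto.
Qed.

(** * Theta functions *)

(* Gaussian binomial coefficients in the base [q ^+ 2]. *)
Fixpoint gbin (m l : nat) : fps :=
  match m, l with
  | _, 0 => 1
  | 0, _.+1 => 0
  | m'.+1, l'.+1 => gbin m' l'.+1 + q ^+ (2 * (m' - l')) * gbin m' l'
  end.

Lemma gbin0 m : gbin m 0 = 1. Proof. by case: m. Qed.
Lemma gbinS m l :
  gbin m.+1 l.+1 = gbin m l.+1 + q ^+ (2 * (m - l)) * gbin m l.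
Proof. by []. Qed.

Lemma gbin_small m l : (m < l)%N -> gbin m l = 0.
Proof.
elim: m l => [|m IHm] [|l] //; rewrite ltnS => ltml.
by rewrite gbinS !IHm ?mulr0 ?addr0 //; apply: leq_trans ltml _.
Qed.

Lemma gbin_eprod l k :
  gbin (l + k) l * (eprod 2 l * eprod 2 k) = eprod 2 (l + k).
Proof.
move def_m: (l + k)%N => m; elim: m l k def_m => [|m IHm] [|l] [|k] //= lk.
- by rewrite !eprod0 !mul1r.
- by rewrite -lk add0n eprod0 !mul1r.
- have lm : l = m by lia.
  rewrite lm gbin_small // subnn muln0 expr0 add0r mul1r eprod0 mulr1 !eprodS.
  rewrite mulrA -{1}[eprod 2 m]mulr1 -(eprod0 2).
  by rewrite (IHm m 0) // addn0.
- have -> : (m - l = k.+1)%N by lia.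
  rewrite mulrDl -mulrA.
  have h1 := IHm l.+1 k ltac:(lia); have h2 := IHm l k.+1 ltac:(lia).
  rewrite [eprod 2 l.+1 in X in _ + X]eprodS [eprod 2 k.+1 in X in X + _]eprodS.
  have -> : gbin m l.+1 * (eprod 2 l.+1 * (eprod 2 k * (1 - q ^+ (2 * k.+1)))) =
    (gbin m l.+1 * (eprod 2 l.+1 * eprod 2 k)) * (1 - q ^+ (2 * k.+1)) by ring.
  have -> : gbin m l * (eprod 2 l * (1 - q ^+ (2 * l.+1)) * eprod 2 k.+1) =
    (gbin m l * (eprod 2 l * eprod 2 k.+1)) * (1 - q ^+ (2 * l.+1)) by ring.
  rewrite h1 h2 eprodS.
  have -> : (2 * m.+1 = 2 * k.+1 + 2 * l.+1)%N by lia.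
  by rewrite exprD; ring.
Qed.

(** The [q]-binomial theorem in base [q^2], homogeneous so that [z] need not be invertible. *)
Lemma rothe (z : fps) m :
  \prod_(0 <= i < m) (z + q ^+ (2 * i)) =
  \sum_(0 <= l < m.+1) gbin m l * q ^+ (l * l.-1) * z ^+ (m - l).
Proof.
elim: m => [|m IHm]; first by rewrite big_nil big_nat1 /= !expr0 !mul1r.
rewrite big_nat_recr //= IHm mulrDr !mulr_suml.
rewrite [RHS]big_nat_recl //= expr0 mulr1 mul1r subn0.
under [X in _ = _ + X]eq_bigr do rewrite mulrDl mulrDl.
rewrite big_split /= addrA; congr (_ + _); last first.
  apply: eq_big_nat => l /andP[_ ltlm].
  have -> : (l.+1 * l = 2 * l + l * l.-1)%N by case: l {ltlm} => // l; nia.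
  have -> : gbin m l * q ^+ (l * l.-1) * z ^+ (m - l) * q ^+ (2 * m) =
    gbin m l * z ^+ (m - l) * q ^+ (l * l.-1) * q ^+ (2 * m) by ring.
  have -> : (2 * m = 2 * (m - l) + 2 * l)%N by lia.
  by rewrite !exprD subSS; ring.
rewrite [X in _ = _ + X]big_nat_recr //= gbin_small // !mul0r addr0.
rewrite big_nat_recl //= gbin0 expr0 !mul1r subn0 -exprSr; congr (_ + _).
apply: eq_big_nat => l /andP[_ ltlm].
by rewrite -mulrA -exprSr -subSn // subSS.
Qed.

Definition tprod (c n : nat) : fps := \prod_(0 <= k < n) (1 + q ^+ (2 * k + c)).

(* The exponent of the l-th term is (l-n)^2 + (c-1)(l-n). *)
Definition jexp (c l n : nat) : nat :=
  (if l <= n then (n - l) * (n - l + 1 - c) else (l - n) * (l - n + c - 1))%N.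

Lemma tprodS c n : tprod c n.+1 = tprod c n * (1 + q ^+ (2 * n + c)).
Proof. by rewrite /tprod big_nat_recr. Qed.

Lemma qX_inj k (f g : fps) : q ^+ k * f = q ^+ k * g -> f = g.
Proof.
apply: mulfI; apply/eqP => /(congr1 (fun f : fps => f k)).
by rewrite fps_qX eqxx.
Qed.

(** A finite Jacobi triple product: [rothe] with [z = q^(2n - c)] and [2n] factors. Each factor with
    [i < n] releases [q^(2i)] and each other one releases [z], which gives the two summands of the
    exponent cancelled at the start. *)
Lemma finite_jtp c n : (0 < n)%N -> (0 < c <= 2)%N ->
  tprod (2 - c) n * tprod c n =
  \sum_(0 <= l < (2 * n).+1) gbin (2 * n) l * q ^+ jexp c l n.
Proof.
move=> n0 c12; apply: (@qX_inj (n * n.-1 + (2 * n - c) * n)).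
have := rothe (q ^+ (2 * n - c)) (2 * n)%N.
rewrite (@big_cat_nat _ _ _ n 0) //=; last by lia.
have -> : \prod_(0 <= i < n) (q ^+ (2 * n - c) + q ^+ (2 * i)) =
    q ^+ (n * n.-1) * tprod (2 - c) n.
  rewrite /tprod [in RHS]big_nat_rev /= add0n.
  have -> : (n * n.-1 = \sum_(0 <= i < n) 2 * i)%N.
    elim: (n) => [|k IHk]; first by rewrite big_nil.
    by rewrite big_nat_recr //= -IHk; case: (k) => // j; nia.
  rewrite expr_sum -big_split /=; apply: eq_big_nat => i /andP[_ ltin].
  rewrite mulrDr mulr1 -exprD addrC; congr (_ + q ^+ _); lia.
have -> : \prod_(n <= i < 2 * n) (q ^+ (2 * n - c) + q ^+ (2 * i)) =
    q ^+ ((2 * n - c) * n) * tprod c n.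
  have -> (F : nat -> fps) : \prod_(n <= i < 2 * n) F i = \prod_(0 <= i < n) F (i + n)%N.
    by rewrite -[X in index_iota X _]add0n big_addn mul2n -addnn addnK.
  have -> : q ^+ ((2 * n - c) * n) = \prod_(0 <= i < n) q ^+ (2 * n - c).
    by rewrite prodr_const_nat subn0 exprM.
  rewrite -big_split /=.
  apply: eq_big_nat => i _; rewrite mulrDr mulr1 -exprD; congr (_ + q ^+ _); lia.
rewrite mulrACA -exprD => ->; rewrite mulr_sumr; apply: eq_big_nat => l /andP[_ ltl].
rewrite -exprM -mulrA -exprD mulrCA -exprD; congr (_ * q ^+ _).
have predE m : (m * m.-1 + m = m * m)%N by case: m => // m; rewrite mulnS addnC.
have := predE n; have := predE l; move: (l * l.-1)%N (n * n.-1)%N => L M eL eM.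
have em : (2 * n - c + c = 2 * n)%N by rewrite subnK //; lia.
move: (2 * n - c)%N em => m em; rewrite /jexp.
case: leqP => leln.
  have [d nE] : exists d, n = (l + d)%N by exists (n - l)%N; lia.
  have -> : (n - l = d)%N by lia.
  have -> : (2 * n - l = n + d)%N by lia.
  have hm : ((m + c) * d = 2 * n * d)%N by rewrite em.
  rewrite nE in eM hm *.
  have [cE|cE] : c = 1%N \/ c = 2%N by lia.
    by rewrite cE addnK in hm *; lia.
  rewrite cE in hm *.
  have -> : (d + 1 - 2 = d.-1)%N by lia.
  by have := predE d; lia.
have [d lE] : exists d, l = (n + d)%N by exists (l - n)%N; lia.
have -> : (l - n = d)%N by lia.
have [e nE] : exists e, n = (d + e)%N by exists (n - d)%N; lia.
have -> : (2 * n - l = e)%N by lia.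
have hm : ((m + c) * d = 2 * n * d)%N by rewrite em.
rewrite lE nE in eL eM hm *.
have [cE|cE] : c = 1%N \/ c = 2%N by lia.
  by rewrite cE addnK in hm *; lia.
by rewrite cE -addnBA // in hm *; lia.
Qed.

Lemma eqmod_cancel n (f g h : fps) :
  h 0%N != 0 -> eqmod n (f * h) (g * h) -> eqmod n f g.
Proof.
by move=> h0; rewrite /eqmod -mulrBl; apply: (@vanish_cancel 0).
Qed.

(** Far from both ends of the row, [gbin] tends to the inverse of [E 2]. *)
Lemma gbin_lim m l n : (l <= n)%N -> (m <= 2 * l.+1)%N -> (m <= 2 * (n - l).+1)%N ->
  eqmod m (E 2 * gbin n l) 1.
Proof.
move=> leln ml mnl.
have El k : (m <= 2 * k.+1)%N -> eqmod m (E 2) (eprod 2 k).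
  by move=> lem; apply: (eqmodW lem); apply: E_eprod.
have st k : (m <= 2 * k.+1)%N -> (k <= n)%N -> eqmod m (eprod 2 n) (eprod 2 k).
  by move=> lem lek; apply: (eqmodW lem); apply: eprod_stable.
apply: (@eqmod_cancel _ _ _ (eprod 2 l * eprod 2 (n - l))).
  by rewrite fpsM0 !eprod_const.
rewrite mul1r -mulrA -{1}(subnKC leln) gbin_eprod subnKC //.
by apply: eqmodM; [apply: El | apply: st => //; lia].
Qed.

(** Near the ends of the row [gbin_lim] is weak, but there the power of [q] is large: at distance
    [d] from the middle the orders add up to at least [2 (n - d + 1) + d (d - 1)], and
    [(d - 1) (d - 2)] is never negative. *)
Lemma jtp_lim c n : (0 < n)%N -> (0 < c <= 2)%N ->
  eqmod (2 * n) (E 2 * (tprod (2 - c) n * tprod c n))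
    (\sum_(0 <= l < (2 * n).+1) q ^+ jexp c l n).
Proof.
move=> n0 c12; rewrite finite_jtp // mulr_sumr !big_seq.
apply: eqmod_sum => l; rewrite mem_index_iota => /andP[_ ltl].
pose m := (2 * (minn l (2 * n - l)).+1)%N.
have lem : eqmod m (E 2 * gbin (2 * n) l) 1 by apply: gbin_lim; lia.
rewrite /eqmod mulrA.
have -> : E 2 * gbin (2 * n) l * q ^+ jexp c l n - q ^+ jexp c l n =
  (E 2 * gbin (2 * n) l - 1) * q ^+ jexp c l n by ring.
apply: (@vanishW _ (m + jexp c l n)).
  rewrite /m /jexp; case: (leqP l n) => leln.
    have [d nE] : exists d, n = (l + d)%N by exists (n - l)%N; lia.
    have -> : (n - l = d)%N by lia.
    have [->|->] : c = 1%N \/ c = 2%N by lia.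
      by nia.
    by case: d nE => [|[|d]]; nia.
  have [d lE] : exists d, l = (n + d)%N by exists (l - n)%N; lia.
  have -> : (l - n = d)%N by lia.
  have [->|->] : c = 1%N \/ c = 2%N by lia.
    by nia.
  by nia.
by apply: vanishM => //; apply: vanish_qX.
Qed.

Lemma tprod1_eprod n :
  tprod 1 n * eprod 1 (2 * n) * eprod 4 n = eprod 2 n * eprod 2 (2 * n).
Proof.
elim: n => [|n IHn]; first by rewrite /tprod big_nil !eprod0 !mul1r.
rewrite tprodS mulnS !eprodS mul1n.
have -> : (2 * n + 1 = (2 * n).+1)%N by lia.
have -> : (2 * n.+1 = (2 * n).+2)%N by lia.
have -> : (2 * (2 * n).+1 = (2 * n).+1 * 2)%N by lia.
have -> : (2 * (2 * n).+2 = (2 * n).+2 * 2)%N by lia.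
have -> : (4 * n.+1 = (2 * n).+2 * 2)%N by lia.
rewrite !exprM; move: IHn; move: (q ^+ (2 * n).+1) (q ^+ (2 * n).+2) => z y.
move: (tprod _ _) (eprod 1 _) (eprod 4 _) (eprod 2 (2 * n)) (eprod 2 n) => t e1 e4 e2' e2 IHn.
have -> : t * (1 + z) * (e1 * (1 - z) * (1 - y)) * (e4 * (1 - y ^+ 2)) =
  (t * e1 * e4) * ((1 - z ^+ 2) * (1 - y) * (1 - y ^+ 2)) by ring.
by rewrite IHn; ring.
Qed.

Lemma tprod2_eprod n : tprod 2 n * eprod 2 n = eprod 4 n.
Proof.
elim: n => [|n IHn]; first by rewrite /tprod big_nil !eprod0 mul1r.
rewrite tprodS !eprodS -IHn.
have -> : (2 * n + 2 = 2 * n.+1)%N by lia.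
have -> : (4 * n.+1 = 2 * n.+1 * 2)%N by lia.
by rewrite [q ^+ (_ * 2)]exprM; move: (q ^+ _) => z; ring.
Qed.

(** [tprod 0] starts with the factor [1 + q^0 = 2]; the congruence pays for one missing last
    factor. *)
Lemma tprod0_tprod2 n : eqmod (2 * n) (tprod 0 n) (tprod 2 n *+ 2).
Proof.
have -> : tprod 2 n *+ 2 = tprod 0 n.+1.
  rewrite /tprod big_nat_recl // muln0 expr0 mulrDl mul1r -mulr2n; congr (_ *+ 2).
  by apply: eq_big_nat => i _; congr (1 + q ^+ _); lia.
rewrite /eqmod tprodS mulrDr mulr1 opprD addrA subrr add0r addn0.
by apply/vanishN/vanishMl/vanish_qX.
Qed.

(** Ramanujan's theta functions, the sums of [q^(n^2)] over the integers and of [q^(n (n + 1) / 2)]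
    over the naturals, entered as eta quotients. Locking keeps them atomic in later computations. *)
HB.lock Definition phi : fps := E 2 ^+ 5 / (E 1 ^+ 2 * E 4 ^+ 2).
HB.lock Definition psi : fps := E 2 ^+ 2 / E 1.

Lemma E_unit j : (0 < j)%N -> E j \is a GRing.unit.
Proof. by move=> j0; rewrite fps_unitE E_const. Qed.

Lemma phi_sum n : (0 < n)%N ->
  eqmod (2 * n) phi (\sum_(0 <= l < (2 * n).+1) q ^+ jexp 1 l n).
Proof.
move=> n0; apply: eqmod_trans (jtp_lim n0 (c := 1) isT) => /=.
apply: (@eqmod_cancel _ _ _ (E 1 ^+ 2 * E 4 ^+ 2)).
  by rewrite fpsM0 !expr2 !fpsM0 !E_const.
rewrite phi.unlock divrK ?unitrM ?unitrX ?E_unit //.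
have h : eqmod (2 * n) (tprod 1 n * E 1 * E 4) (E 2 * E 2).
  apply: (@eqmod_trans _ (tprod 1 n * eprod 1 (2 * n) * eprod 4 n)).
    apply: eqmodM; [apply: eqmodM; [exact: eqmod_refl|]|].
      by apply: E_eprodW.
    by apply: (eqmodW _ (@E_eprod 4 n isT)); lia.
  rewrite tprod1_eprod; apply/eqmod_sym/eqmodM.
    by apply: (eqmodW _ (@E_eprod 2 n isT)); lia.
  by apply: E_eprodW.
have -> : E 2 * (tprod 1 n * tprod 1 n) * (E 1 ^+ 2 * E 4 ^+ 2) =
   E 2 * (tprod 1 n * E 1 * E 4) ^+ 2 by ring.
have -> : E 2 ^+ 5 = E 2 * (E 2 * E 2) ^+ 2 by ring.
by apply: eqmodM; [exact: eqmod_refl | apply/eqmod_sym/eqmodX].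
Qed.

Lemma V2_psi : V 2 psi = E 4 ^+ 2 / E 2.
Proof. by rewrite psi.unlock rmorph_div ?E_unit // rmorphXn /= !V_E. Qed.

(** The doubling is there because [d (d + 1)] takes each of its values twice as [d] runs over the
    integers. *)
Lemma psi_sum n : (0 < n)%N ->
  eqmod (2 * n) (V 2 psi *+ 2) (\sum_(0 <= l < (2 * n).+1) q ^+ jexp 2 l n).
Proof.
move=> n0; apply: eqmod_trans (jtp_lim n0 (c := 2) isT) => /=.
apply: (@eqmod_trans _ (E 2 * ((tprod 2 n *+ 2) * tprod 2 n))); last first.
  apply: eqmodM; first exact: eqmod_refl.
  by apply: eqmodM; [apply/eqmod_sym/tprod0_tprod2 | apply: eqmod_refl].
apply: (@eqmod_cancel _ _ _ (E 2)); first by rewrite E_const.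
rewrite V2_psi -mulrnAl divrK ?E_unit //.
have h : eqmod (2 * n) (tprod 2 n * E 2) (E 4).
  apply: (@eqmod_trans _ (eprod 4 n)).
    rewrite -tprod2_eprod; apply: eqmodM; first exact: eqmod_refl.
    by apply: (eqmodW _ (@E_eprod 2 n isT)); lia.
  by apply/eqmod_sym/(eqmodW _ (@E_eprod 4 n isT)); lia.
have -> : E 2 * (tprod 2 n *+ 2 * tprod 2 n) * E 2 =
  2%:R * (tprod 2 n * E 2) ^+ 2 by ring.
have -> : E 4 ^+ 2 *+ 2 = 2%:R * E 4 ^+ 2 by ring.
by apply: eqmodM; [exact: eqmod_refl | apply/eqmod_sym/eqmodX].
Qed.

Lemma sum_even_odd (F : nat -> fps) n :
  \sum_(0 <= l < (2 * n).+1) F l =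
  \sum_(0 <= l < n.+1) F (2 * l)%N + \sum_(0 <= l < n) F (2 * l + 1)%N.
Proof.
elim: n => [|n IHn]; first by rewrite !big_nat1 big_nil addr0.
have -> : (2 * n.+1 = (2 * n).+2)%N by lia.
rewrite big_nat_recr // big_nat_recr // IHn /=.
rewrite [in RHS]big_nat_recr // [X in _ = _ + X]big_nat_recr //=.
have -> : (2 * n.+1 = (2 * n).+2)%N by lia.
by rewrite addn1; ring.
Qed.

(** Squares split by parity: the even ones are [4 d^2], the odd ones [4 d (d + 1) + 1]. *)
Lemma phi_split : phi = V 4 phi + 2%:R * q * V 8 psi.
Proof.
apply: eqmod_eq => n.
apply: (@eqmodW _ (2 * n.+1)); first by lia.
have n0 : (0 < 2 * n.+1)%N by [].
apply: (eqmod_trans (eqmodW _ (phi_sum n0))); first by lia.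
rewrite sum_even_odd; apply: eqmodD.
  apply/eqmod_sym/(eqmod_trans (eqmod_V 3 (phi_sum (ltn0Sn n)))).
  rewrite rmorph_sum; have -> : \sum_(0 <= l < (2 * n.+1).+1) V 4 (q ^+ jexp 1 l n.+1) =
    \sum_(0 <= l < (2 * n.+1).+1) q ^+ jexp 1 (2 * l) (2 * n.+1).
    apply: eq_big_nat => l _; rewrite rmorphXn /= V_q -exprM; congr (q ^+ _).
    rewrite /jexp leq_pmul2l //; case: leqP => _; rewrite -mulnBr; nia.
  exact: eqmod_refl.
have -> : 2%:R * q * V 8 psi = q * V 4 (V 2 psi *+ 2).
  by rewrite rmorphMn /= V_V //; ring.
apply: eqmod_sym; apply: (@eqmod_trans _ (q * V 4
   (\sum_(0 <= l < 2 * n.+1) q ^+ jexp 2 l n.+1))).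
  apply: eqmodM; first exact: eqmod_refl.
  apply: eqmod_V; apply: (eqmod_trans (psi_sum (ltn0Sn n))).
  (* [psi_sum] has one term more than the odd half; its exponent lies beyond the precision. *)
  rewrite /eqmod big_nat_recr //= [X in vanish _ X]addrAC subrr add0r.
  apply: (vanishW _ (@vanish_qX _)).
  by rewrite /jexp; case: (leqP (2 * n.+1) n.+1) => h; [lia | rewrite mul2n -addnn addnK; nia].
rewrite rmorph_sum mulr_sumr.
have -> : \sum_(0 <= l < 2 * n.+1) q * V 4 (q ^+ jexp 2 l n.+1) =
    \sum_(0 <= l < 2 * n.+1) q ^+ jexp 1 (2 * l + 1) (2 * n.+1).
  apply: eq_big_nat => l _; rewrite rmorphXn /= V_q -exprM -exprS; congr (q ^+ _).
  rewrite /jexp; case: (leqP l n.+1) => h1; case: (leqP (2 * l + 1) (2 * n.+1)) => h2.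
  - have [d dE] : exists d, n.+1 = (l + d.+1)%N by exists (n - l)%N; lia.
    have -> : (n.+1 - l = d.+1)%N by lia.
    have -> : (2 * n.+1 - (2 * l + 1) = 2 * d + 1)%N by lia.
    by rewrite addn1 subSS addnK; nia.
  - have -> : l = n.+1 by lia.
    have -> : (2 * n.+1 + 1 - 2 * n.+1 = 1)%N by lia.
    by rewrite subnn.
  - by lia.
  - have [d ->] : exists d, l = (n.+1 + d)%N by exists (l - n.+1)%N; lia.
    have -> : (n.+1 + d - n.+1 = d)%N by lia.
    have -> : (2 * (n.+1 + d) + 1 - 2 * n.+1 = 2 * d + 1)%N by lia.
    by nia.
exact: eqmod_refl.
Qed.

(** * Eta quotients *)

(** Eta quotients as exponent vectors over the divisors of 12: products, powers and inverses become
    integer arithmetic, and [!etaE] reduces identities between pure quotients to computation. *)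
Definition eta (e1 e2 e3 e4 e6 e12 : int) : fps :=
  E 1 ^ e1 * E 2 ^ e2 * E 3 ^ e3 * E 4 ^ e4 * E 6 ^ e6 * E 12 ^ e12.
Arguments eta (e1 e2 e3 e4 e6 e12)%_Z.

Lemma eta_unit e1 e2 e3 e4 e6 e12 : eta e1 e2 e3 e4 e6 e12 \is a GRing.unit.
Proof. by rewrite !unitrM !unitrXz ?E_unit. Qed.

Lemma eta0 : eta 0 0 0 0 0 0 = 1.
Proof. by rewrite /eta !expr0z !mulr1. Qed.

Lemma etaM a1 a2 a3 a4 a6 a12 b1 b2 b3 b4 b6 b12 :
  eta a1 a2 a3 a4 a6 a12 * eta b1 b2 b3 b4 b6 b12 =
  eta (a1 + b1) (a2 + b2) (a3 + b3) (a4 + b4) (a6 + b6) (a12 + b12).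
Proof. by rewrite /eta !exprzDr ?E_unit //; ring. Qed.

Lemma etaV e1 e2 e3 e4 e6 e12 :
  (eta e1 e2 e3 e4 e6 e12)^-1 =
  eta (- e1) (- e2) (- e3) (- e4) (- e6) (- e12).
Proof.
apply: (mulIr (eta_unit e1 e2 e3 e4 e6 e12)).
by rewrite mulVr ?eta_unit // etaM !addNr eta0.
Qed.

Lemma etaX e1 e2 e3 e4 e6 e12 (k : nat) :
  eta e1 e2 e3 e4 e6 e12 ^+ k =
  eta (e1 * k%:Z) (e2 * k%:Z) (e3 * k%:Z) (e4 * k%:Z) (e6 * k%:Z) (e12 * k%:Z).
Proof. by rewrite /eta !exprMn !exprnP !exprz_exp. Qed.

Lemma eta_E1 : E 1 = eta 1 0 0 0 0 0. Proof. by rewrite /eta !expr0z expr1z !mulr1. Qed.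
Lemma eta_E2 : E 2 = eta 0 1 0 0 0 0.
Proof. by rewrite /eta !expr0z expr1z !mulr1 !mul1r. Qed.
Lemma eta_E3 : E 3 = eta 0 0 1 0 0 0.
Proof. by rewrite /eta !expr0z expr1z !mulr1 !mul1r. Qed.
Lemma eta_E4 : E 4 = eta 0 0 0 1 0 0.
Proof. by rewrite /eta !expr0z expr1z !mulr1 !mul1r. Qed.
Lemma eta_E6 : E 6 = eta 0 0 0 0 1 0.
Proof. by rewrite /eta !expr0z expr1z !mulr1 !mul1r. Qed.
Lemma eta_E12 : E 12 = eta 0 0 0 0 0 1.
Proof. by rewrite /eta !expr0z expr1z !mul1r. Qed.
Definition etaE := (eta_E1, eta_E2, eta_E3, eta_E4, eta_E6, eta_E12, etaX, etaV, etaM).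

Lemma sgn_E1E : sgn (E 1) = eta (-1) 3 0 (-1) 0 0.
Proof.
have u : E 1 * E 4 \is a GRing.unit by rewrite unitrM !E_unit.
apply: (mulIr u); have -> : sgn (E 1) * (E 1 * E 4) = E 2 ^+ 3 by rewrite -sgn_E1; ring.
by rewrite !etaE.
Qed.

Lemma sgn_E3E : sgn (E 3) = eta 0 0 (-1) 0 3 (-1).
Proof.
have u : E 3 * E 12 \is a GRing.unit by rewrite unitrM !E_unit.
have -> : E 3 = V 3 (E 1) by rewrite V_E.
have e12 : E 12 = V 3 (E 4) by rewrite V_E.
have e6 : E 6 = V 3 (E 2) by rewrite V_E.
rewrite sgn_V3 sgn_E1E /eta !expr0z !mulr1 !mul1r !rmorphM /= !rmorphXz ?E_unit //=.
by rewrite !V_E.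
Qed.

Lemma sgn_eta e1 e2 e3 e4 e6 e12 :
  sgn (eta e1 e2 e3 e4 e6 e12) =
  eta (- e1) (e2 + 3%:Z * e1) (- e3) (e4 - e1) (e6 + 3%:Z * e3) (e12 - e3).
Proof.
have s2 j : (0 < j)%N -> sgn (E (2 * j)) = E (2 * j) by move=> j0; rewrite -(V_E 1) // sgn_V2.
rewrite {1}/eta !rmorphM /= !rmorphXz ?E_unit //= sgn_E1E sgn_E3E.
rewrite (s2 1%N) // (s2 2%N) // (s2 3%N) // (s2 6%N) //.
have ez (x : fps) (a b c : int) : x \is a GRing.unit -> (x ^ a) ^ b = x ^ (a * b).
  by rewrite exprz_exp.
rewrite /eta !expr0z !mulr1 !mul1r.
have X3 (a b c d e f : fps) (k : int) : a \is a GRing.unit -> b \is a GRing.unit ->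
  c \is a GRing.unit -> (a * b * c) ^ k = a ^ k * b ^ k * c ^ k.
  by move=> ua ub uc; rewrite !exprzMl // unitrM ua ub.
rewrite !X3 ?unitrXz ?E_unit // !exprz_exp !mulN1r.
rewrite !exprzDr ?E_unit //; ring.
Qed.

(** The exponents of [E 4] and [E 12] are zero because [q -> q^2] would send these factors to [E 8]
    and [E 24], outside the vector. *)
Lemma V2_eta e1 e2 e3 e6 : V 2 (eta e1 e2 e3 0 e6 0) = eta 0 e1 0 e2 e3 e6.
Proof.
rewrite /eta !expr0z !mulr1 !rmorphM /= !rmorphXz ?E_unit //= !V_E //; ring.
Qed.

Lemma V3_eta e1 e2 e4 : V 3 (eta e1 e2 0 e4 0 0) = eta 0 0 e1 0 e2 e4.
Proof.
rewrite /eta !expr0z !mulr1 !rmorphM /= !rmorphXz ?E_unit //= !V_E //; ring.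
Qed.

Lemma eta_const e1 e2 e3 e4 e6 e12 : eta e1 e2 e3 e4 e6 e12 0%N = 1.
Proof.
have Ez (f : fps) (k : int) : f 0%N = 1 -> (f ^ k) 0%N = 1.
  move=> f0; have fn n : (f ^+ n) 0%N = 1.
    by elim: n => // n IHn; rewrite exprS fpsM0 f0 IHn.
  case: k => n; first by rewrite -exprnP.
  rewrite NegzE -exprnN.
  have fu : f ^+ n.+1 \is a GRing.unit by rewrite fps_unitE fn.
  by have := congr1 (fun g : fps => g 0%N) (mulVr fu); rewrite fpsM0 fn mulr1.
by rewrite /eta !fpsM0 !Ez ?E_const.
Qed.

(** With constant term 1 the coefficient of [q] behaves like a logarithm, and only [E 1] contributes
    to it. It later separates the candidates left by a factorization. *)
Lemma eta_coef1 e1 e2 e3 e4 e6 e12 : eta e1 e2 e3 e4 e6 e12 1%N = - e1.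
Proof.
pose c1 (f : fps) (a : int) := f 0%N = 1 /\ f 1%N = a.
have c1M f g a b : c1 f a -> c1 g b -> c1 (f * g) (a + b).
  by move=> [f0 f1] [g0 g1]; split; rewrite ?fpsM0 ?fpsM1 ?f0 ?g0 ?f1 ?g1 ?mul1r ?mulr1 1?addrC.
have c1X f a (n : nat) : c1 f a -> c1 (f ^+ n) (a * n%:Z).
  move=> fa; elim: n => [|n IHn]; first by split; rewrite ?expr0 ?mulr0 ?fps1.
  by rewrite exprS intS mulrDr mulr1; apply: c1M.
have c1V f a : c1 f a -> c1 f^-1 (- a).
  move=> [f0 f1]; have fu : f \is a GRing.unit by rewrite fps_unitE f0.
  have g0 : f^-1 0%N = 1.
    by have := congr1 (fun g : fps => g 0%N) (mulVr fu); rewrite fpsM0 f0 mulr1.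
  split=> //; have := congr1 (fun g : fps => g 1%N) (mulVr fu).
  rewrite fpsM1 f0 f1 g0 mulr1 mul1r fps1 => /eqP; rewrite addrC addr_eq0.
  by move=> /eqP ->.
have c1Z f a k : c1 f a -> c1 (f ^ k) (a * k).
  move=> fa; case: k => n; first by rewrite -exprnP; apply: c1X.
  by rewrite NegzE -exprnN mulrN; apply/c1V/c1X.
have c1E j : (0 < j)%N -> c1 (E j) (- (j == 1)%:R).
  move=> j0; split; first exact: E_const.
  by rewrite /E /Eq big_nat1 coefB coef1 coefXn muln1 sub0r eq_sym.
have [] : c1 (eta e1 e2 e3 e4 e6 e12) (-1 * e1 + 0 * e2 + 0 * e3 + 0 * e4 + 0 * e6 + 0 * e12).
  have z j k (j0 : (0 < j)%N) := c1Z _ _ k (c1E j j0).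
  exact: (c1M _ _ _ _ (c1M _ _ _ _ (c1M _ _ _ _ (c1M _ _ _ _ (c1M _ _ _ _
    (z 1%N e1 isT) (z 2%N e2 isT)) (z 3%N e3 isT)) (z 4%N e4 isT)) (z 6%N e6 isT))
    (z 12%N e12 isT)).
by move=> _ ->; ring.
Qed.

(** * The cubic modular equation *)

Lemma descent (m0 : nat) (f : fps) :
  vanish m0 f -> (forall m, (m0 <= m)%N -> vanish m f -> vanish m.+1 f) -> f = 0.
Proof.
move=> f0 fS; apply: vanish_eq0 => n; apply: (@vanishW _ (m0 + n)); first exact: leq_addl.
by elim: n => [|n IHn]; rewrite ?addn0 // addnS; apply: fS => //; apply: leq_addr.
Qed.

HB.lock Definition phim : fps := sgn phi.

Lemma phiE : phi = eta (-2) 5 0 (-2) 0 0. Proof. by rewrite phi.unlock !etaE. Qed.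
Lemma psiE : psi = eta (-1) 2 0 0 0 0. Proof. by rewrite psi.unlock !etaE. Qed.
Lemma phimE : phim = eta 2 (-1) 0 0 0 0. Proof. by rewrite phim.unlock phiE sgn_eta. Qed.
Lemma V3_phi : V 3 phi = eta 0 0 (-2) 0 5 (-2). Proof. by rewrite phiE V3_eta. Qed.
Lemma V3_phim : V 3 phim = eta 0 0 2 0 (-1) 0. Proof. by rewrite phimE V3_eta. Qed.
Lemma V3_psi : V 3 psi = eta 0 0 (-1) 0 2 0. Proof. by rewrite psiE V3_eta. Qed.

Lemma phi_phim : phi * phim = V 2 phim ^+ 2.
Proof. by rewrite phiE phimE V2_eta !etaE. Qed.

Lemma psi_sqr : psi ^+ 2 = phi * V 2 psi.
Proof. by rewrite phiE psiE V2_eta !etaE. Qed.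

Lemma phim_split : phim = V 4 phi - 2%:R * q * V 8 psi.
Proof.
rewrite phim.unlock {1}phi_split rmorphD !rmorphM rmorph_nat /= sgn_q.
have V2k k f : sgn (V (2 * k) f) = V (2 * k) f by rewrite -V_V // sgn_V2.
have e4 : sgn (V 4 phi) = V 4 phi := V2k 2%N phi.
have e8 : sgn (V 8 psi) = V 8 psi := V2k 4%N psi.
by rewrite e4 e8; ring.
Qed.

(** The defect satisfies [e(q) = - 2 e(q^2)], so its order of vanishing would double for ever. *)
Lemma phi_V2 : phi ^+ 2 + phim ^+ 2 = V 2 phi ^+ 2 *+ 2.
Proof.
apply/eqP; rewrite -subr_eq0; apply/eqP; set e := _ - _.
have eV : e = - (V 2 e *+ 2).
  rewrite /e rmorphB rmorphD rmorphMn !rmorphXn /= V_V //.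
  have -> : phi ^+ 2 + phim ^+ 2 = (phi + phim) ^+ 2 - phi * phim *+ 2 by ring.
  by rewrite phi_phim {1}phi_split {1}phim_split; ring.
apply: (@descent 1).
  case=> // _; have := congr1 (fun f : fps => f 0%N) eV.
  by rewrite fpsN fpsMn V0; lia.
move=> m m0 em; rewrite eV; apply: vanishN.
rewrite mulr2n; apply: (@vanishW _ (2 * m)); first by lia.
by apply: vanishD; apply: vanish_V.
Qed.

Lemma phi_quartic : phi ^+ 4 - phim ^+ 4 = q * V 2 psi ^+ 4 *+ 16.
Proof.
have -> : phi ^+ 4 - phim ^+ 4 =
  (phi ^+ 2 + phim ^+ 2) * ((phi + phim) * (phi - phim)) by ring.
have -> : phi + phim = V 4 phi *+ 2 by rewrite {1}phi_split phim_split; ring.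
have -> : phi - phim = q * V 8 psi *+ 4 by rewrite {1}phi_split phim_split; ring.
have V4psi : V 4 psi ^+ 2 = V 4 phi * V 8 psi by rewrite -rmorphXn psi_sqr rmorphM /= V_V.
have V2psi : V 2 psi ^+ 2 = V 2 phi * V 4 psi by rewrite -rmorphXn psi_sqr rmorphM /= V_V.
rewrite phi_V2.
have -> : V 2 psi ^+ 4 = V 2 phi ^+ 2 * (V 4 phi * V 8 psi).
  by rewrite -V4psi (exprM _ 2 2) V2psi; ring.
ring.
Qed.

HB.lock Definition L : fps := phi * V 3 phi.
HB.lock Definition L' : fps := phim * V 3 phim.
HB.lock Definition Spsi : fps := V 2 (psi * V 3 psi).

Lemma LE : L = eta (-2) 5 (-2) (-2) 5 (-2). Proof. by rewrite L.unlock V3_phi phiE etaM. Qed.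
Lemma L'E : L' = eta 2 (-1) 2 0 (-1) 0. Proof. by rewrite L'.unlock V3_phim phimE etaM. Qed.
Lemma SpsiE : Spsi = eta 0 (-1) 0 2 (-1) 2.
Proof. by rewrite Spsi.unlock V3_psi psiE etaM V2_eta. Qed.

Lemma LL' : L * L' = V 2 L' ^+ 2.
Proof. by rewrite LE L'E V2_eta !etaE. Qed.

Lemma Spsi_sqr : Spsi ^+ 2 = V 2 L * V 2 Spsi.
Proof.
by rewrite Spsi.unlock -rmorphXn -rmorphM /= exprMn -rmorphXn psi_sqr rmorphM /= L.unlock; congr (V 2 _);
  rewrite rmorphM /= !V_V //; ring.
Qed.

Lemma L_split : L + L' = (V 4 L + q ^+ 4 * V 4 Spsi *+ 4) *+ 2.
Proof.
rewrite L.unlock L'.unlock {1 2}phi_split phim_split !(rmorphD, rmorphN, rmorphM, rmorph_nat) /= V_q.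
rewrite Spsi.unlock !rmorphM /= !V_V //.
rewrite -[(3 * 4)%N]/12%N -[(3 * 8)%N]/24%N -[(4 * 3)%N]/12%N -[(4 * 2 * 3)%N]/24%N -[(4 * 2)%N]/8%N.
by ring.
Qed.

(* Write e for the first defect and N for the second one.  The identities below
   bound N by V 2 N and V 4 e, and [q * e] by V 2 N, V 2 e and V 4 e; since [V 2]
   doubles the order of vanishing, both defects vanish to every order. *)
Lemma L_cubic :
  L - L' = q * Spsi *+ 4 /\
  L ^+ 2 - L * L' + L' ^+ 2 = (V 2 L *+ 2 - V 2 L') ^+ 2.
Proof.
pose e := L - L' - q * Spsi *+ 4.
pose N := L ^+ 2 - L * L' + L' ^+ 2 - (V 2 L *+ 2 - V 2 L') ^+ 2.
(* The conjugate of [e]: in [e * f] the series [L] and [L'] enter only through their sum and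
   product. The order of [f] is exactly 1, which is what dividing by it costs. *)
pose f := L - L' + q * Spsi *+ 4.
have e2 : V 2 e = V 2 L - V 2 L' - q ^+ 2 * V 2 Spsi *+ 4.
  by rewrite /e !rmorphB rmorphMn rmorphM /= V_q.
have e4 : V 4 e = V 4 L - V 4 L' - q ^+ 4 * V 4 Spsi *+ 4.
  by rewrite /e !rmorphB rmorphMn rmorphM /= V_q.
have N2 : V 2 N = V 2 L ^+ 2 - V 2 L * V 2 L' + V 2 L' ^+ 2 - (V 4 L *+ 2 - V 4 L') ^+ 2.
  by rewrite /N !(rmorphB, rmorphD, rmorphM, rmorphMn, rmorphXn) /= !V_V.
pose M := V 4 L *+ 2 - V 4 L'.
have LL : L + L' = (M - V 4 e) *+ 2.
  by rewrite L_split e4 /M; ring.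
have NE : N = V 4 e * (V 4 e - M *+ 2) *+ 4 - V 2 N *+ 4.
  have NE : N = (L + L') ^+ 2 - L * L' *+ 3 - (V 2 L *+ 2 - V 2 L') ^+ 2.
    by rewrite /N; ring.
  by rewrite [LHS]NE LL LL' N2 /M; ring.
have eE : e * f = V 4 e * (V 4 e - M *+ 2) *+ 4 - V 2 N *+ 4 + V 2 L * V 2 e *+ 4.
  have -> : e * f = (L + L') ^+ 2 - L * L' *+ 4 - q ^+ 2 * Spsi ^+ 2 *+ 16.
    by rewrite /e /f; ring.
  by rewrite LL LL' Spsi_sqr N2 e2 /M; ring.
have [L0 L1] : L 0%N = 1 /\ L 1%N = 2 by rewrite LE eta_const eta_coef1.
have [L'0 L'1] : L' 0%N = 1 /\ L' 1%N = - 2%:R by rewrite L'E eta_const eta_coef1.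
have S0 : Spsi 0%N = 1 by rewrite SpsiE eta_const.
have qS1 : (q * Spsi) 1%N = 1 by rewrite fps_qM S0.
have V1 g : V 2 g 1%N = 0 by [].
(* Cancelling [f] loses one order, so [2 m >= m + 2] is needed; hence the direct check of the
   coefficients 0 and 1. *)
have e_N m : (2 <= m)%N -> vanish m e -> vanish m N -> vanish m.+1 e /\ vanish m.+1 N.
  move=> m2 em Nm.
  have e2m : vanish (2 * m) (V 2 e) by apply: vanish_V.
  have N2m : vanish (2 * m) (V 2 N) by apply: vanish_V.
  have e4m : vanish (2 * m) (V 4 e).
    by apply: (@vanishW _ (4 * m)); [lia | apply: vanish_V].
  have Mn g k : vanish (2 * m) g -> vanish (2 * m) (g *+ k).
    by rewrite -mulr_natr; apply: vanishMr.
  have rhs : vanish (2 * m) (V 4 e * (V 4 e - M *+ 2) *+ 4 - V 2 N *+ 4).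
    by apply: vanishB; apply: Mn => //; apply: vanishMr.
  split; last by rewrite NE; apply: vanishW rhs; lia.
  apply: (@vanish_cancel 1 _ _ f).
  - by case=> // _; rewrite /f fpsD fpsB fpsMn fps_qM0 L0 L'0.
  - by rewrite /f fpsD fpsB fpsMn qS1 L1 L'1.
  - rewrite eE; apply: (@vanishW _ (2 * m)); first by lia.
    by apply: vanishD => //; apply/Mn/vanishMl.
have eN m : vanish (2 + m) e /\ vanish (2 + m) N.
  elim: m => [|m [em Nm]]; last by rewrite addnS; apply: e_N => //; lia.
  split; case=> [|[|//]] _.
  - by rewrite /e !fpsB fpsMn fps_qM0 L0 L'0.
  - by rewrite /e !fpsB fpsMn qS1 L1 L'1.
  - by rewrite /N !(fpsB, fpsD, fpsMn, expr2, fpsM0) !V0 L0 L'0.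
  - by rewrite /N !(fpsB, fpsD, fpsMn, expr2, fpsM0, fpsM1) !V0 !V1 L0 L'0 L1 L'1.
split; apply/eqP; rewrite -subr_eq0; apply/eqP; apply: vanish_eq0 => m.
  by apply: (@vanishW _ (2 + m)); [lia | case: (eN m)].
by apply: (@vanishW _ (2 + m)); [lia | case: (eN m)].
Qed.

(** * A uniformizer for level 12 *)

(* D = 1 + p and w^2 = phi(-q) phi(-q^3) / (phi(q) phi(q^3)), where
   p = (phi(q)^2 - phi(q^3)^2) / (2 phi(q^3)^2) is the level 12 parameter of Alaca and
   Williams. *)
HB.lock Definition D : fps := eta (-2) 3 6 (-1) (-9) 3.
HB.lock Definition w : fps := eta 2 (-3) 2 1 (-3) 1.
HB.lock Definition sig : fps := eta (-1) 1 3 2 (-7) 2.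

Lemma D_const : D 0%N = 1. Proof. by rewrite D.unlock eta_const. Qed.
Lemma D_coef1 : D 1%N = 2. Proof. by rewrite D.unlock eta_coef1. Qed.
Lemma w_const : w 0%N = 1. Proof. by rewrite w.unlock eta_const. Qed.
Lemma w_coef1 : w 1%N = - 2%:R. Proof. by rewrite w.unlock eta_coef1. Qed.
Lemma D_unit : D \is a GRing.unit. Proof. by rewrite fps_unitE D_const. Qed.
Lemma V3_phi_unit : V 3 phi \is a GRing.unit. Proof. by rewrite V3_phi eta_unit. Qed.
Lemma L_unit : L \is a GRing.unit. Proof. by rewrite LE eta_unit. Qed.

Lemma L'_w : L' = w ^+ 2 * L. Proof. by rewrite LE L'E w.unlock !etaE. Qed.
Lemma V2_L'_w : V 2 L' = w * L. Proof. by rewrite LE L'E V2_eta w.unlock !etaE. Qed.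
Lemma phim_w : phim ^+ 2 * D = w ^+ 3 * phi ^+ 2.
Proof. by rewrite phimE phiE D.unlock w.unlock !etaE. Qed.
Lemma V3_phim_w : V 3 phim ^+ 2 = D * w * V 3 phi ^+ 2.
Proof. by rewrite V3_phim V3_phi D.unlock w.unlock !etaE. Qed.
Lemma D_sqr : D ^+ 2 * (phim * V 3 phi ^+ 3) = phi * V 3 phim ^+ 3.
Proof. by rewrite V3_phim V3_phi phimE phiE D.unlock !etaE. Qed.

Lemma phi_V2_w : V 2 phi ^+ 2 * D *+ 2 = phi ^+ 2 * (D + w ^+ 3).
Proof. by rewrite -mulrnAl -phi_V2 mulrDl phim_w; ring. Qed.

Lemma V3_phi_V2 : V 3 phi ^+ 2 + V 3 phim ^+ 2 = V 6 phi ^+ 2 *+ 2.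
Proof.
have := congr1 (V 3) phi_V2.
by rewrite rmorphD rmorphMn !rmorphXn /= V_V.
Qed.

Lemma V3_phi_V2_w : V 6 phi ^+ 2 *+ 2 = V 3 phi ^+ 2 * (1 + D * w).
Proof. by rewrite -V3_phi_V2 V3_phim_w; ring. Qed.

Lemma V2_L : V 2 L = V 2 phi * V 6 phi.
Proof. by rewrite L.unlock rmorphM /= V_V. Qed.

Lemma V2_L_sqr : V 2 L ^+ 2 * D *+ 4 = L ^+ 2 * (D + w ^+ 3) * (1 + D * w).
Proof.
rewrite V2_L.
have -> : (V 2 phi * V 6 phi) ^+ 2 * D *+ 4 =
  (V 2 phi ^+ 2 * D *+ 2) * (V 6 phi ^+ 2 *+ 2) by ring.
by rewrite phi_V2_w V3_phi_V2_w L.unlock; ring.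
Qed.

(** Expanding the square in [L_cubic] isolates [V 2 L * V 2 L']; as [V 2 L'] is [w * L], the
    relation becomes linear in [V 2 L] once its square is eliminated by [V2_L_sqr]. *)
Lemma V2_L_D : V 2 L * D *+ 4 = L * (D + w) ^+ 2.
Proof.
have [_ cubic] := L_cubic.
have wu : w * L \is a GRing.unit by rewrite w.unlock LE etaM eta_unit.
apply: (mulIr wu).
have -> : V 2 L * D *+ 4 * (w * L) = D * (V 2 L * V 2 L' *+ 4) by rewrite V2_L'_w; ring.
have -> : V 2 L * V 2 L' *+ 4 =
    V 2 L ^+ 2 *+ 4 + V 2 L' ^+ 2 - (L ^+ 2 - L * L' + L' ^+ 2) by rewrite cubic; ring.
have -> : D * (V 2 L ^+ 2 *+ 4 + V 2 L' ^+ 2 - (L ^+ 2 - L * L' + L' ^+ 2)) =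
    V 2 L ^+ 2 * D *+ 4 + D * (V 2 L' ^+ 2 - (L ^+ 2 - L * L' + L' ^+ 2)) by ring.
by rewrite V2_L_sqr V2_L'_w L'_w; ring.
Qed.

Lemma D_w_quartic : (D + w) ^+ 4 = D * (D + w ^+ 3) * (1 + D * w) *+ 4.
Proof.
have L2u : L ^+ 2 \is a GRing.unit by rewrite unitrX ?L_unit.
apply: (mulrI L2u).
have -> : L ^+ 2 * (D + w) ^+ 4 = (L * (D + w) ^+ 2) ^+ 2 by ring.
rewrite -V2_L_D.
have -> : L ^+ 2 * (D * (D + w ^+ 3) * (1 + D * w) *+ 4) =
   D * (L ^+ 2 * (D + w ^+ 3) * (1 + D * w)) *+ 4 by ring.
by rewrite -V2_L_sqr; ring.
Qed.

(** The quartic relation factors as [f * g = 0], and the coefficient of [q] in [g] is not zero. *)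
Lemma D_w : w ^+ 2 * (D *+ 2 - 1) = D * (2%:R - D).
Proof.
pose f := w ^+ 2 * (D *+ 2 - 1) - D * (2%:R - D).
pose g := w ^+ 2 * (D *+ 2 + 1) - D * (D + 1 *+ 2).
have /eqP : f * g = 0.
  have -> : f * g = D * (D + w ^+ 3) * (1 + D * w) *+ 4 - (D + w) ^+ 4.
    by rewrite /f /g; ring.
  by rewrite D_w_quartic subrr.
rewrite mulf_eq0 => /orP[|/eqP g0]; first by rewrite subr_eq0 => /eqP.
have : g 1%N = 0 by rewrite g0.
rewrite /g fpsB expr2 !(fpsM1, fpsM0, fpsD, fpsMn, fps1).
by rewrite D_const D_coef1 w_const w_coef1.
Qed.

Lemma fourth_root (f g : fps) :
  0 < f 0%N -> 0 < g 0%N -> f ^+ 4 = g ^+ 4 -> f = g.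
Proof.
move=> f0 g0 /eqP; rewrite -subr_eq0.
have -> : f ^+ 4 - g ^+ 4 = (f - g) * ((f + g) * (f ^+ 2 + g ^+ 2)) by ring.
rewrite !mulf_eq0 subr_eq0 => /or3P[/eqP // | /eqP h | /eqP h].
  by have := congr1 (fun h : fps => h 0%N) h; rewrite fpsD fps0; lia.
have := congr1 (fun h : fps => h 0%N) h.
by rewrite fpsD !expr2 !fpsM0 fps0; nia.
Qed.

(** [D_sqr] gives [D ^+ 2] as a theta quotient. After [q -> q^2] it is the squares of these thetas
    that are known through [D] and [w], hence the fourth powers; positive constant terms pick the
    root. *)
Lemma V2_D : V 2 D * (1 + D * w) = D + w.
Proof.
apply: fourth_root.
- by rewrite fpsM0 V0 fpsD fpsM0 fps1 D_const w_const.
- by rewrite fpsD D_const w_const.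
have D2 := congr1 (fun f => V 2 f ^+ 2) D_sqr.
rewrite !(rmorphM, rmorphXn) /= !V_V // -[(2 * 3)%N]/6%N in D2.
have V6 : V 6 phim ^+ 2 = V 3 phi * V 3 phim.
  by rewrite -rmorphM phi_phim rmorphXn /= V_V.
have u : phi * phim * V 3 phi ^+ 6 * D \is a GRing.unit.
  by rewrite V3_phi phiE phimE D.unlock !etaE eta_unit.
apply: (mulIr u).
have -> : (V 2 D * (1 + D * w)) ^+ 4 * (phi * phim * V 3 phi ^+ 6 * D) =
    V 2 D ^+ 4 * (phi * phim) * (V 3 phi ^+ 2 * (1 + D * w)) ^+ 3 * D * (1 + D * w) by ring.
rewrite -V3_phi_V2_w [in LHS]phi_phim.
have -> : V 2 D ^+ 4 * V 2 phim ^+ 2 * (V 6 phi ^+ 2 *+ 2) ^+ 3 * D * (1 + D * w) =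
    (V 2 D ^+ 2 * (V 2 phim * V 6 phi ^+ 3)) ^+ 2 * D * (1 + D * w) *+ 8 by ring.
rewrite D2.
have -> : (V 2 phi * V 6 phim ^+ 3) ^+ 2 * D * (1 + D * w) *+ 8 =
    (V 2 phi ^+ 2 * D *+ 2) * (V 6 phim ^+ 2) ^+ 3 * (1 + D * w) *+ 4 by ring.
rewrite phi_V2_w V6 D_w_quartic.
have -> : phi ^+ 2 * (D + w ^+ 3) * (V 3 phi * V 3 phim) ^+ 3 * (1 + D * w) *+ 4 =
    phi * V 3 phi ^+ 3 * (phi * V 3 phim ^+ 3) * (D + w ^+ 3) * (1 + D * w) *+ 4 by ring.
by rewrite -D_sqr; ring.
Qed.

(** The ratio [f / g] is fixed by [q -> q^2], hence constant by [V_fix]. *)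
Lemma V2_ratio (f g : fps) :
  f 0%N = 1 -> g 0%N = 1 -> V 2 f * g = f * V 2 g -> f = g.
Proof.
move=> f0 g0 fg.
have gu : g \is a GRing.unit by rewrite fps_unitE g0.
have Vgu : V 2 g \is a GRing.unit by rewrite fps_unitE V0 g0.
have /V_fix : V 2 (f / g) = f / g.
  rewrite rmorph_div //=; apply: (mulIr gu); apply: (mulIr Vgu).
  by rewrite mulrAC !divrK.
rewrite fpsM0 f0 mul1r.
have -> : g^-1 0%N = 1.
  by have := congr1 (fun f : fps => f 0%N) (mulVr gu); rewrite fpsM0 g0 mulr1.
by move=> /(canRL (divrK gu)); rewrite mul1r.
Qed.

(** Both sides transform alike under [q -> q^2], so [V2_ratio] applies. This is what makes [2 D - 1]
    an eta quotient. *)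
Lemma phi_multiplier : phi ^+ 2 = (D *+ 2 - 1) * V 3 phi ^+ 2.
Proof.
have c0 (f : fps) : f 0%N = 1 -> (f ^+ 2) 0%N = 1 by move=> f0; rewrite expr2 fpsM0 f0.
apply: V2_ratio.
- by rewrite c0 // phiE eta_const.
- by rewrite fpsM0 c0 ?V0 ?fpsB ?fpsMn ?D_const // phiE eta_const.
rewrite [V 2 (phi ^+ 2)]rmorphXn [V 2 (_ * _)]rmorphM rmorphXn rmorphB rmorphMn rmorph1 /=.
rewrite V_V // -[(2 * 3)%N]/6%N.
have u : D * (1 + D * w) != 0.
  apply/eqP => /(congr1 (fun f : fps => f 0%N)).
  by rewrite fpsM0 fpsD fpsM0 fps1 D_const w_const.
apply: (mulIf u); apply: (@fps_mulIn 1).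
have -> : V 2 phi ^+ 2 * ((D *+ 2 - 1) * V 3 phi ^+ 2) * (D * (1 + D * w)) *+ 2 =
   (V 2 phi ^+ 2 * D *+ 2) * ((D *+ 2 - 1) * V 3 phi ^+ 2) * (1 + D * w) by ring.
have -> : phi ^+ 2 * ((V 2 D *+ 2 - 1) * V 6 phi ^+ 2) * (D * (1 + D * w)) *+ 2 =
   phi ^+ 2 * (V 6 phi ^+ 2 *+ 2) * D * (V 2 D * (1 + D * w) *+ 2 - (1 + D * w)) by ring.
rewrite V2_D phi_V2_w V3_phi_V2_w.
have -> : phi ^+ 2 * (D + w ^+ 3) * ((D *+ 2 - 1) * V 3 phi ^+ 2) * (1 + D * w) =
   phi ^+ 2 * V 3 phi ^+ 2 * (1 + D * w) *
   (D * (D *+ 2 - 1) + w * (w ^+ 2 * (D *+ 2 - 1))) by ring.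
by rewrite D_w; ring.
Qed.

Lemma D2_unit : D *+ 2 - 1 \is a GRing.unit.
Proof. by rewrite fps_unitE fpsB fpsMn D_const fps1. Qed.

Lemma L_D : L * ((D - 1) * (D + 1)) = q * Spsi * (D *+ 2 - 1) *+ 4.
Proof.
have [linear _] := L_cubic.
have -> : q * Spsi * (D *+ 2 - 1) *+ 4 = (q * Spsi *+ 4) * (D *+ 2 - 1) by ring.
rewrite -linear L'_w.
have -> : (L - w ^+ 2 * L) * (D *+ 2 - 1) =
   L * (D *+ 2 - 1 - w ^+ 2 * (D *+ 2 - 1)) by ring.
by rewrite D_w; ring.
Qed.

Lemma V3_phi_D : V 3 phi ^+ 4 * ((D - 1) ^+ 3 * (D + 1)) =
  q ^+ 3 * V 6 psi ^+ 4 * (D *+ 2 - 1) *+ 16.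
Proof.
have quartic : V 3 phi ^+ 4 - V 3 phim ^+ 4 = q ^+ 3 * V 6 psi ^+ 4 *+ 16.
  have := congr1 (V 3) phi_quartic.
  by rewrite rmorphB rmorphMn rmorphM !rmorphXn /= V_q V_V.
have -> : q ^+ 3 * V 6 psi ^+ 4 * (D *+ 2 - 1) *+ 16 =
  (q ^+ 3 * V 6 psi ^+ 4 *+ 16) * (D *+ 2 - 1) by ring.
rewrite -quartic.
have -> : V 3 phim ^+ 4 = (D * w * V 3 phi ^+ 2) ^+ 2 by rewrite -V3_phim_w -exprM.
have -> : (V 3 phi ^+ 4 - (D * w * V 3 phi ^+ 2) ^+ 2) * (D *+ 2 - 1) =
  V 3 phi ^+ 4 * (D *+ 2 - 1 - D ^+ 2 * (w ^+ 2 * (D *+ 2 - 1))) by ring.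
by rewrite D_w; ring.
Qed.

(** [V3_phi_D] divided by [L_D] leaves [(D - 1) ^+ 2]; the sign of the root is read off the
    coefficient of [q]. *)
Lemma D_sub1 : D - 1 = q * eta (-1) 3 3 (-2) (-9) 6 *+ 2.
Proof.
set k := eta _ _ _ _ _ _.
have kE : k ^+ 2 * V 3 phi ^+ 4 * Spsi = V 6 psi ^+ 4 * L.
  have -> : V 6 psi = V 2 (V 3 psi) by rewrite V_V.
  by rewrite /k V3_psi V2_eta V3_phi SpsiE LE !etaE.
have u : V 3 phi ^+ 4 * Spsi * (D *+ 2 - 1) \is a GRing.unit.
  by rewrite unitrM D2_unit andbT V3_phi SpsiE !etaE eta_unit.
have sqr : (D - 1) ^+ 2 = (q * k *+ 2) ^+ 2.
  apply: (mulIr u); apply: (@qX_inj 1); rewrite expr1; apply: (@fps_mulIn 3).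
  have -> : q * ((D - 1) ^+ 2 * (V 3 phi ^+ 4 * Spsi * (D *+ 2 - 1))) *+ 4 =
    V 3 phi ^+ 4 * (D - 1) ^+ 2 * (q * Spsi * (D *+ 2 - 1) *+ 4) by ring.
  rewrite -L_D.
  have -> : V 3 phi ^+ 4 * (D - 1) ^+ 2 * (L * ((D - 1) * (D + 1))) =
    L * (V 3 phi ^+ 4 * ((D - 1) ^+ 3 * (D + 1))) by ring.
  rewrite V3_phi_D.
  have -> : q * ((q * k *+ 2) ^+ 2 * (V 3 phi ^+ 4 * Spsi * (D *+ 2 - 1))) *+ 4 =
    q ^+ 3 * (k ^+ 2 * V 3 phi ^+ 4 * Spsi) * (D *+ 2 - 1) *+ 16 by ring.
  by rewrite kE; ring.
have /eqP : (D - 1 - q * k *+ 2) * (D - 1 + q * k *+ 2) = 0.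
  by apply/eqP; rewrite -subr_sqr sqr subrr.
rewrite mulf_eq0 => /orP[|/eqP h]; first by rewrite subr_eq0 => /eqP.
have := congr1 (fun f : fps => f 1%N) h.
by rewrite fpsD fpsB fpsMn fps_qM D_coef1 /k eta_const fps1.
Qed.

(** [L_D] divided by [D_sub1], with [2 D - 1] absorbed by [phi_multiplier]. *)
Lemma D_sig : D + 1 = sig *+ 2.
Proof.
set k := eta (-1) 3 3 (-2) (-9) 6.
have u : L * k * V 3 phi ^+ 2 \is a GRing.unit.
  by rewrite LE V3_phi /k !etaE eta_unit.
apply: (mulIr u); apply: (@qX_inj 1); rewrite expr1; apply: (@fps_mulIn 1).
have -> : q * ((D + 1) * (L * k * V 3 phi ^+ 2)) *+ 2 =
   L * ((q * k *+ 2) * (D + 1)) * V 3 phi ^+ 2 by ring.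
rewrite -D_sub1 L_D.
have -> : q * Spsi * (D *+ 2 - 1) *+ 4 * V 3 phi ^+ 2 =
   q * Spsi * ((D *+ 2 - 1) * V 3 phi ^+ 2) *+ 4 by ring.
rewrite -phi_multiplier -mulrA.
have <- : sig * (L * k * V 3 phi ^+ 2) = Spsi * phi ^+ 2.
  by rewrite V3_phi phiE LE SpsiE sig.unlock /k !etaE.
ring.
Qed.

(** * The series of the statement in terms of D *)

HB.lock Definition Di : fps := D^-1.
HB.lock Definition xif : fps := xi.
HB.lock Definition gam : fps := gamma.
HB.lock Definition G0 : fps := PDOgf.

Lemma sdivE (f g : fps) : g 0%N = 1 -> (sdiv f g : fps) = f / g.
Proof. by move=> g0; rewrite -sinvE. Qed.

Lemma const_M (f g : fps) : f 0%N = 1 -> g 0%N = 1 -> (f * g) 0%N = 1.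
Proof. by move=> f0 g0; rewrite fpsM0 f0 g0. Qed.
Lemma const_X (f : fps) k : f 0%N = 1 -> (f ^+ k) 0%N = 1.
Proof. by move=> f0; elim: k => // k IHk; rewrite exprS const_M. Qed.

Lemma xifE : xif = eta (-1) 5 (-5) 0 1 0.
Proof.
rewrite xif.unlock /xi sdivE; last first.
  rewrite spowE; apply: const_M; first exact: (@E_const 1 isT).
  exact/const_X/(@E_const 3 isT).
rewrite !spowE -[smul _ _]/(E 2 ^+ 5 * E 6) -[smul _ _]/(E 1 * E 3 ^+ 5).
by rewrite !etaE.
Qed.

Lemma gamE : gam = eta 5 5 (-15) 0 5 0.
Proof.
rewrite gam.unlock /gamma sdivE; last by rewrite spowE; apply/const_X/(@E_const 3 isT).
rewrite !spowE -[smul _ _]/(E 1 ^+ 5 * (E 2 ^+ 5 * E 6 ^+ 5)).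
by rewrite -[Eq 3]/(E 3) !etaE.
Qed.

Lemma G0E : G0 = eta (-1) 0 (-1) 1 2 (-1).
Proof.
rewrite G0.unlock /PDOgf sdivE; last first.
  apply: const_M; first exact: (@E_const 1 isT).
  by apply: const_M; [exact: (@E_const 3 isT) | exact: (@E_const 12 isT)].
rewrite !spowE -[smul _ _]/(E 4 * E 6 ^+ 2) -[smul _ _]/(E 1 * (E 3 * E 12)).
by rewrite !etaE.
Qed.

Lemma D_Di : D * Di = 1. Proof. by rewrite Di.unlock mulrV // D_unit. Qed.
Lemma DiE : Di = eta 2 (-3) (-6) 1 9 (-3).
Proof. by rewrite Di.unlock D.unlock etaV. Qed.
Lemma sgn_D : sgn D = Di.
Proof. by rewrite DiE D.unlock sgn_eta. Qed.
Lemma sgn_Di : sgn Di = D. Proof. by rewrite -sgn_D sgnK. Qed.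

Lemma xif_sig : xif = sig * (D *+ 2 - 1) * Di ^+ 2.
Proof.
have u : V 3 phi ^+ 2 \is a GRing.unit by rewrite unitrX ?V3_phi_unit.
apply: (mulIr u).
have -> : sig * (D *+ 2 - 1) * Di ^+ 2 * V 3 phi ^+ 2 =
   sig * Di ^+ 2 * ((D *+ 2 - 1) * V 3 phi ^+ 2) by ring.
by rewrite -phi_multiplier V3_phi phiE xifE sig.unlock DiE !etaE.
Qed.

Lemma xif_D : xif *+ 2 = (1 + D) * (D *+ 2 - 1) * Di ^+ 2.
Proof. by rewrite xif_sig -!mulrnAl -D_sig addrC. Qed.

Lemma xif1_D : (xif - 1) *+ 2 = (D - 1) * Di ^+ 2.
Proof. by rewrite mulrnBl xif_D; ring: D_Di. Qed.

Lemma V2_xif : V 2 xif *+ 4 = 2%:R + D + Di.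
Proof.
have -> : V 2 xif = sig ^+ 2 * Di by rewrite xifE V2_eta sig.unlock DiE !etaE.
have -> : sig ^+ 2 * Di *+ 4 = (sig *+ 2) ^+ 2 * Di by ring.
by rewrite -D_sig; ring: D_Di.
Qed.

Lemma sig_sqr : sig ^+ 2 = V 2 xif * D.
Proof. by rewrite xifE V2_eta sig.unlock D.unlock !etaE. Qed.

Lemma V2_gam : V 2 gam ^+ 2 = sig ^+ 5 * gam.
Proof. by rewrite gamE V2_eta sig.unlock !etaE. Qed.

Lemma gam_U m f : gam ^+ (2 * m) * U f = U (sig ^+ (5 * m) * (gam ^+ m * f)).
Proof.
by rewrite -U_V2M rmorphXn /= !exprM V2_gam exprMn mulrA.
Qed.

(** * The first generating functions *)

(** After [q -> q^2] and multiplication by [4 q] this is the linear half of [L_cubic], with [L - L']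
    expanded by [phi_split]. *)
Lemma psi_dissection :
  psi * V 3 psi = V 4 psi * V 6 phi + q * V 2 phi * V 12 psi.
Proof.
apply: (@V_inj 1); have [linear _] := L_cubic.
apply: (@qX_inj 1); rewrite expr1; apply: (@fps_mulIn 3).
rewrite -Spsi.unlock -linear L.unlock L'.unlock {1 2}phi_split phim_split.
rewrite !(rmorphD, rmorphN, rmorphM, rmorph_nat) /= V_q [V 2 q]V_q !V_V //.
rewrite -[(3 * 4)%N]/12%N -[(3 * 8)%N]/24%N -[(2 * 4)%N]/8%N -[(2 * 6)%N]/12%N.
rewrite -[(2 * 2)%N]/4%N -[(2 * 12)%N]/24%N.
by ring.
Qed.

Lemma U_psi : U (psi * V 3 psi) = V 2 psi * V 3 phi.
Proof.
apply: U_eq; rewrite psi_dissection.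
have s k f : sgn (V (2 * k) f) = V (2 * k) f by rewrite -V_V // sgn_V2.
rewrite rmorphD !rmorphM /= sgn_q.
rewrite (s 2%N psi : sgn (V 4 psi) = V 4 psi) (s 3%N phi : sgn (V 6 phi) = V 6 phi).
rewrite (s 1%N phi : sgn (V 2 phi) = V 2 phi) (s 6%N psi : sgn (V 12 psi) = V 12 psi).
rewrite !V_V // -[(2 * 2)%N]/4%N -[(2 * 3)%N]/6%N.
by ring.
Qed.

Lemma U_L : U L = V 2 L *+ 2 - V 2 L'.
Proof.
have [linear _] := L_cubic.
apply: U_eq; have -> : sgn L = L' by rewrite LE L'E sgn_eta.
rewrite L_split; congr (_ *+ 2).
rewrite rmorphB rmorphMn /= !V_V // -[(2 * 2)%N]/4%N.
have -> : V 4 L' = V 4 L - q ^+ 4 * V 4 Spsi *+ 4.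
  have := congr1 (V 4) linear; rewrite rmorphB rmorphMn rmorphM /= V_q => <-.
  by rewrite opprB addrC subrK.
by ring.
Qed.

Lemma square_root (f g : fps) :
  0 < f 0%N -> 0 < g 0%N -> f ^+ 2 = g ^+ 2 -> f = g.
Proof.
move=> f0 g0 /eqP; rewrite eqf_sqr => /orP[/eqP // | /eqP fg].
by move: f0; rewrite fg fpsN; lia.
Qed.

(** By [U_L] and the second half of [L_cubic], [U L] is a square root of [L^2 - L L' + L'^2]; times
    [(2 D - 1)^2], the latter becomes [L^2] times a perfect square in [D] through [D_w]. *)
Lemma U_L_D : U L * (D *+ 2 - 1) = L * (D ^+ 2 - D + 1).
Proof.
have [_ cubic] := L_cubic; rewrite U_L.
have [L0 L'0] : L 0%N = 1 /\ L' 0%N = 1 by rewrite LE L'E !eta_const.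
apply: square_root.
- by rewrite fpsM0 !fpsB !fpsMn fps1 !V0 L0 L'0 D_const.
- by rewrite fpsM0 fpsD fpsB expr2 fpsM0 L0 D_const.
rewrite exprMn -cubic L'_w.
have -> : (L ^+ 2 - L * (w ^+ 2 * L) + (w ^+ 2 * L) ^+ 2) * (D *+ 2 - 1) ^+ 2 =
  L ^+ 2 * ((D *+ 2 - 1) ^+ 2 - (w ^+ 2 * (D *+ 2 - 1)) * (D *+ 2 - 1) +
     (w ^+ 2 * (D *+ 2 - 1)) ^+ 2) by ring.
by rewrite D_w; ring.
Qed.

Definition G (k : nat) : fps := iter k U G0.

Lemma G1E : G 1 = V 2 (eta (-4) 2 0 0 (-2) 0 * (psi * V 3 psi)) * L.
Proof.
have -> : G 1 = U G0 by [].
(* Only [psi(q) psi(q^3)] mixes parities; the other factor is a series in [q^2] and leaves [U]. *)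
have -> : G0 = V 2 (eta (-2) 1 0 0 (-1) 0) * (psi * V 3 psi).
  by rewrite V2_eta V3_psi psiE G0E !etaE.
rewrite U_V2M U_psi [V 2 (_ * (psi * _))]rmorphM /= -Spsi.unlock V3_phi psiE !V2_eta SpsiE LE !etaE.

by [].
Qed.

Lemma G2E : gam * G 2 * D ^+ 2 = xif ^+ 2 * (D ^+ 2 - D + 1).
Proof.
have -> : G 2 = U (G 1) by [].
rewrite G1E U_V2M.
have u : (D *+ 2 - 1) * V 3 phi ^+ 2 \is a GRing.unit.
  by rewrite unitrM D2_unit unitrX ?V3_phi_unit.
apply: (mulIr u).
set c := eta _ _ _ _ _ _ * _.
have -> : gam * (c * U L) * D ^+ 2 * ((D *+ 2 - 1) * V 3 phi ^+ 2) =
  gam * c * D ^+ 2 * V 3 phi ^+ 2 * (U L * (D *+ 2 - 1)) by ring.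
rewrite U_L_D -phi_multiplier.
have -> : gam * c * D ^+ 2 * V 3 phi ^+ 2 * (L * (D ^+ 2 - D + 1)) =
  (gam * c * D ^+ 2 * V 3 phi ^+ 2 * L) * (D ^+ 2 - D + 1) by ring.
have -> : gam * c * D ^+ 2 * V 3 phi ^+ 2 * L = xif ^+ 2 * phi ^+ 2.
  by rewrite /c gamE V3_psi V3_phi phiE psiE LE xifE D.unlock !etaE.
by ring.
Qed.

Lemma two_neq0 k : (2%:R : fps) ^+ k != 0.
Proof.
apply: expf_neq0; apply/eqP => /(congr1 (fun f : fps => f 0%N)).
by rewrite fpsMn fps1.
Qed.

(** [sig] and [xif] become polynomials in [D] and [1 / D] only after doubling, so the trace is
    computed for a multiple [2^k f]. *)
Lemma U_scaled (k : nat) (f F g : fps) :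
  f * 2%:R ^+ k = F -> F + sgn F = V 2 g * 2%:R ^+ k.+1 -> U f = g.
Proof.
move=> <- Fg; apply: U_eq.
apply: (mulIf (two_neq0 k)); move: Fg; rewrite rmorphM rmorphXn rmorph_nat /= exprS => Fg.
by rewrite mulrDl Fg; ring.
Qed.

Definition sgnE :=
  (rmorphXn sgn, rmorphM sgn, rmorphD sgn, rmorphN sgn, rmorph_nat sgn, rmorph1 sgn, rmorphMn sgn).
Definition V2E :=
  (rmorphXn (V 2), rmorphM (V 2), rmorphD (V 2), rmorphN (V 2), rmorph_nat (V 2), rmorph1 (V 2),
   rmorphMn (V 2)).

Lemma sigf : sig *+ 2 = 1 + D. Proof. by rewrite -D_sig addrC. Qed.

Lemma H3E : gam ^+ 2 * G 3 = xif ^+ 4 * (xif *+ 4 - 3%:R) ^+ 2.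
Proof.
have -> : G 3 = U (G 2) by [].
rewrite -[2%N in LHS]/(2 * 1)%N gam_U muln1 expr1.
have -> : gam * G 2 = xif ^+ 2 * (D ^+ 2 - D + 1) * Di ^+ 2.
  by rewrite -G2E; ring: D_Di.
(* Seven doublings: five for [sig ^+ 5] and two for [xif ^+ 2]. *)
apply: (@U_scaled 7 _ ((1 + D) ^+ 5 * ((1 + D) * (D *+ 2 - 1) * Di ^+ 2) ^+ 2 *
  ((D ^+ 2 - D + 1) * Di ^+ 2))).
  by rewrite -xif_D -sigf; ring.
have -> : V 2 (xif ^+ 4 * (xif *+ 4 - 3%:R) ^+ 2) * 2%:R ^+ 8 =
    (V 2 xif *+ 4) ^+ 4 * (V 2 xif *+ 4 - 3%:R) ^+ 2.
  by rewrite !V2E; ring.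
by rewrite V2_xif !sgnE /= sgn_D sgn_Di; ring: D_Di.
Qed.

(* The coefficients stay variables here so that a morphism can be pushed inside without
   unfolding large numerals; those of h4 are read off the q-expansion of gamma^4 G_4. *)
Definition quintic (R : comNzRingType) (a0 a1 a2 a3 a4 a5 u : R) : R :=
  a0 + a1 * u + a2 * u ^+ 2 + a3 * u ^+ 3 + a4 * u ^+ 4 + a5 * u ^+ 5.

Lemma rmorph_quintic (R S : comNzRingType) (f : {rmorphism R -> S}) a0 a1 a2 a3 a4 a5 u :
  f (quintic a0 a1 a2 a3 a4 a5 u) =
  quintic (f a0) (f a1) (f a2) (f a3) (f a4) (f a5) (f u).
Proof. by rewrite /quintic !rmorphD !rmorphM; congr (_ + _ * _ + _ * _ + _ * _ + _ * _ + _ * _); rewrite rmorphXn. Qed.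

Definition h4 (R : comNzRingType) (u : R) : R :=
  quintic (- 729%:R) 3645%:R (- 4680%:R) 2544%:R (- 640%:R) 64%:R u.

Lemma rmorph_h4 (R S : comNzRingType) (f : {rmorphism R -> S}) u : f (h4 u) = h4 (f u).
Proof. by rewrite /h4 rmorph_quintic; congr quintic; rewrite ?rmorphN rmorph_nat. Qed.

(** This is [2^14 sig^10 xi^4 (4 xi - 3)^2] at [d = D], [e = 1 / D]: ten doublings for [sig] and
    four for [xi]. *)
Definition h4_lift (R : comNzRingType) (d e : R) : R :=
  (1 + d) ^+ 10 * ((1 + d) * (d *+ 2 - 1) * e ^+ 2) ^+ 4 *
  ((1 + d) * (d *+ 2 - 1) * e ^+ 2 *+ 2 - 3%:R) ^+ 2.

Lemma rmorph_h4_lift (R S : comNzRingType) (f : {rmorphism R -> S}) d e :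
  f (h4_lift d e) = h4_lift (f d) (f e).
Proof.
by rewrite /h4_lift !(rmorphXn, rmorphM, rmorphD, rmorphN, rmorphMn, rmorph_nat, rmorph1).
Qed.

Lemma h4_trace (R : comNzRingType) (d e y : R) : d * e = 1 -> y *+ 4 = 2%:R + d + e ->
  (h4_lift d e + h4_lift e d) * 2%:R ^+ 4 =
  y ^+ 7 * h4 (y *+ 2) * 2%:R ^+ 15 * 2%:R ^+ 4.
Proof.
move=> de y4.
(* Beyond [(4 y)^7] there remains [2^5 h4(2 y)], an integral polynomial in [4 y]; the spare [2 ^+ 4]
   serves this purpose. *)
have -> : y ^+ 7 * h4 (y *+ 2) * 2%:R ^+ 15 * 2%:R ^+ 4 = (y *+ 4) ^+ 7 *
  quintic (- (729%:R * 32%:R)) (3645%:R * 16%:R) (- (4680%:R * 8%:R)) (2544%:R * 4%:R)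
    (- (640%:R * 2%:R)) 64%:R (y *+ 4).
  by rewrite /h4 /quintic; ring.
by rewrite y4 /quintic /h4_lift; ring: de.
Qed.

Lemma H4E : gam ^+ 4 * G 4 = xif ^+ 7 * h4 (xif *+ 2).
Proof.
have -> : G 4 = U (G 3) by [].
rewrite -[4%N in LHS]/(2 * 2)%N gam_U H3E.
apply: (@U_scaled 14 _ (h4_lift D Di)).
  by rewrite /h4_lift -xif_D -sigf; ring.
rewrite [V 2 (_ * _)](rmorphM (V 2)) (rmorphXn (V 2)) /= (rmorph_h4 (V 2)) (rmorphMn (V 2)) /=.
apply: (@mulIf _ _ (two_neq0 4)).
by rewrite -(h4_trace D_Di V2_xif) (rmorph_h4_lift sgn) /= sgn_D sgn_Di.
Qed.

(** By [D_w], [2 / D - 1] is an eta quotient too. The cube is what separates [gamma^4 G_2] from the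
    known [gamma G_2]. *)
Lemma gam3 : gam ^+ 3 = (Di *+ 2 - 1) ^+ 5 * xif ^+ 5.
Proof.
have -> : Di *+ 2 - 1 = eta 4 (-2) (-4) 0 2 0; last by rewrite gamE xifE !etaE.
have -> : Di *+ 2 - 1 = w ^+ 2 * (D *+ 2 - 1) * Di ^+ 2 by rewrite D_w; ring: D_Di.
apply: (mulIr (unitrX 2 V3_phi_unit)).
have -> : w ^+ 2 * (D *+ 2 - 1) * Di ^+ 2 * V 3 phi ^+ 2 =
   w ^+ 2 * Di ^+ 2 * ((D *+ 2 - 1) * V 3 phi ^+ 2) by ring.
by rewrite -phi_multiplier V3_phi phiE w.unlock DiE !etaE.
Qed.

(* Written so that it is visibly (1 + e)^2 modulo 4. *)
Definition h2 (R : comNzRingType) (e : R) : R :=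
  (1 + e) ^+ 2 + 4%:R * (10%:R * e + 48%:R * e ^+ 2 - 56%:R * e ^+ 3 + 18%:R * e ^+ 4
  - 4%:R * e ^+ 5 - 28%:R * e ^+ 6 + 48%:R * e ^+ 7 - 32%:R * e ^+ 8 + 8%:R * e ^+ 9).

(** At [e = 1 / D] the argument of [h4] is [2 xi], and the two terms on the left are [gamma^4 G_4]
    and [gamma^4 G_2] divided by [xi^7]. *)
Lemma h4_h2 (R : comNzRingType) (e : R) :
  h4 (2%:R + e - e ^+ 2) - (e *+ 2 - 1) ^+ 5 * (1 - e + e ^+ 2) =
  (1 - e) * h2 e *+ 2.
Proof. by rewrite /h4 /quintic /h2; ring. Qed.

(** [Phi] read in the ring [fps], see [PhiE]. The index 2 has an explicit closed form, from which
    [Delta 3] is derived. *)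
Definition Delta (k : nat) : fps := gam ^+ (2 ^ k) * (G (k + 2) - G k).

Lemma Delta_S k : Delta k.+1 = U (sig ^+ (5 * 2 ^ k) * Delta k).
Proof.
rewrite /Delta; have -> : G (k.+1 + 2) - G k.+1 = U (G (k + 2) - G k) by [].
by rewrite expnS gam_U.
Qed.

Lemma Delta2 : Delta 2 = xif ^+ 7 * ((1 - Di) * h2 Di *+ 2).
Proof.
have xi2 : xif *+ 2 = 2%:R + Di - Di ^+ 2 by rewrite xif_D; ring: D_Di.
rewrite -h4_h2 -xi2 /Delta -[(2 ^ 2)%N]/4%N -[(2 + 2)%N]/4%N mulrBr H4E.
have -> : gam ^+ 4 * G 2 = gam ^+ 3 * (gam * G 2) by ring.
have -> : gam * G 2 = xif ^+ 2 * (1 - Di + Di ^+ 2).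
  transitivity (gam * G 2 * D ^+ 2 * Di ^+ 2); first by ring: D_Di.
  by rewrite G2E; ring: D_Di.
by rewrite gam3; move: (h4 _) => t; ring.
Qed.

(** * Integral polynomials in 2 xi *)

Definition ev (P : {poly int}) (z : fps) : fps := (map_poly intr P).[z].

Lemma evD P Q z : ev (P + Q) z = ev P z + ev Q z.
Proof. by rewrite /ev rmorphD hornerD. Qed.
Lemma evN P z : ev (- P) z = - ev P z.
Proof. by rewrite /ev rmorphN hornerN. Qed.
Lemma evM P Q z : ev (P * Q) z = ev P z * ev Q z.
Proof. by rewrite /ev rmorphM hornerM. Qed.
Lemma evC (c : int) z : ev c%:P z = c%:~R.
Proof. by rewrite /ev map_polyC hornerC. Qed.
Lemma ev0 z : ev 0 z = 0. Proof. by rewrite -[0]/(0%:P) evC. Qed.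
Lemma ev1 z : ev 1 z = 1. Proof. by rewrite -[1]/(1%:P) evC. Qed.
Lemma evX z : ev 'X z = z.
Proof. by rewrite /ev map_polyX hornerX. Qed.
Lemma evXn k z : ev 'X^k z = z ^+ k.
Proof. by rewrite /ev map_polyXn hornerXn. Qed.
Lemma evC2 z : ev 2%:P z = 2%:R. Proof. by rewrite evC. Qed.
Definition evE := (evD, evN, evM, evXn, evX, ev1, ev0, evC2, evC).

Lemma ev_V P z : V 2 (ev P z) = ev P (V 2 z).
Proof.
elim/poly_ind: P => [|P c IHP]; first by rewrite !ev0 rmorph0.
by rewrite !(evD, evM, evX, evC) (rmorphD (V 2)) (rmorphM (V 2)) (rmorph_int (V 2)) /= IHP.
Qed.

Lemma ev_comp P Q z : ev (P \Po Q) z = ev P (ev Q z).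
Proof. by rewrite /ev map_comp_poly horner_comp. Qed.

Definition dbl (P : {poly int}) : {poly int} := P \Po ('X * 2%:P).

Lemma ev_dbl P z : ev (dbl P) z = ev P (z *+ 2).
Proof. by rewrite ev_comp evM evX evC mulr_natr. Qed.

(** These powers of 2 are the growth of the valuation with [M] in the theorem. *)
Lemma coef_dbl P i : (dbl P)`_i = P`_i * 2 ^+ i.
Proof.
elim/poly_ind: P i => [|P c IHP] i; first by rewrite /dbl comp_poly0 !coef0 mul0r.
rewrite /dbl comp_polyD comp_polyM comp_polyX comp_polyC !coefD !coefC mulrA.
rewrite coefMC !coefMX -/(dbl P); case: i => [|i] /=; first by rewrite mul0r !add0r mulr1.
by rewrite !addr0 IHP exprSr mulrA.
Qed.

HB.lock Definition y : fps := V 2 xif *+ 4.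

Lemma yE : y = 2%:R + D + Di. Proof. by rewrite y.unlock V2_xif. Qed.
Lemma sgn_y : sgn y = y. Proof. by rewrite y.unlock (rmorphMn sgn) /= sgn_V2. Qed.
Lemma ev_y P : ev P y = V 2 (ev P (xif *+ 4)).
Proof. by rewrite y.unlock ev_V (rmorphMn (V 2)). Qed.

(* Laurent polynomials in D form the ring Z[y] + Z[y] D.  Modulo 2 and y it is the
   group algebra of the group of order 2 generated by D, graded by a boolean. *)
Definition lau (c : option bool) (g : fps) : Prop :=
  exists u v : {poly int}, g = ev u y + ev v y * D /\
  (if c is Some b then 2 %| (if b then u else v)`_0 else true)%Z.

(** [None] records no parity and absorbs; otherwise parities add, as for the powers of [D]. *)
Definition add_grade (c c' : option bool) : option bool :=
  if c is Some b then (if c' is Some b' then Some (b (+) b') else None) else None.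

Lemma lauW c g : lau c g -> lau None g.
Proof. by case=> u [v [-> _]]; exists u, v. Qed.

Lemma lauD c g g' : lau c g -> lau c g' -> lau c (g + g').
Proof.
case=> u [v [-> uv]] [u' [v' [-> uv']]]; exists (u + u'), (v + v').
split; first by rewrite !evD; ring.
by case: c uv uv' => [[]|] //= uv uv'; rewrite coefD rpredD.
Qed.

Lemma lauM c c' g g' : lau c g -> lau c' g' -> lau (add_grade c c') (g * g').
Proof.
case=> u [v [-> uv]] [u' [v' [-> uv']]].
exists (u * u' - v * v'), (u * v' + v * u' + ('X - 2%:P) * (v * v')).
(* The quadratic equation of [D] over [Z[y]]; modulo 2 and [y] it reads [D^2 = 1]. *)
have D2 : D ^+ 2 = (y - 2%:R) * D - 1 by rewrite yE; ring: D_Di.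
split.
  rewrite !evE.
  have -> : (ev u y + ev v y * D) * (ev u' y + ev v' y * D) =
    ev u y * ev u' y + (ev u y * ev v' y + ev v y * ev u' y) * D +
    ev v y * ev v' y * D ^+ 2 by ring.
  by rewrite D2; ring.
case: c uv => [b|] //=; case: c' uv' => [b'|] //=.
case: b b' => [] [] /= h h'.
- rewrite !coefD !coef0M coefB coefX coefC /=.
  by apply: rpredD; [apply: rpredD; [exact: dvdz_mulr | exact: dvdz_mull] | exact: dvdz_mulr].
- rewrite coefB !coef0M rpredB //; [exact: dvdz_mulr | exact: dvdz_mull].
- rewrite coefB !coef0M rpredB //; [exact: dvdz_mull | exact: dvdz_mulr].
- rewrite !coefD !coef0M coefB coefX coefC /=.
  by apply: rpredD; [apply: rpredD; [exact: dvdz_mull | exact: dvdz_mulr] | exact: dvdz_mulr].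
Qed.

Lemma lau_int c (k : int) : c != Some true -> lau c k%:~R.
Proof.
move=> c1; exists k%:P, 0; split; first by rewrite evC ev0 mul0r addr0.
by case: c c1 => [[]|] //=; rewrite coef0.
Qed.

Lemma lau_D : lau (Some true) D.
Proof. by exists 0, 1; split; rewrite ?ev0 ?ev1 ?mul1r ?add0r //= coef0. Qed.

Lemma lau_Di : lau (Some true) Di.
Proof.
exists ('X - 2%:P), (-1); split.
  by rewrite !evE yE; ring.
by rewrite /= coefB coefX coefC.
Qed.

Lemma lau_double b g : lau None g -> lau (Some b) (g *+ 2).
Proof.
case=> u [v [-> _]]; exists (u * 2%:P), (v * 2%:P); split.
  by rewrite !evE; ring.
by case: b; rewrite /= coefMC dvdz_mull.
Qed.

Lemma lauX b g n : lau (Some b) g -> lau (Some (b && odd n)) (g ^+ n).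
Proof.
move=> gb; elim: n => [|n IHn].
  by rewrite andbF expr0 -[1]/(1%:~R); apply: lau_int.
have -> : Some (b && odd n.+1) = add_grade (Some b) (Some (b && odd n)).
  by case: (b) => //=.
by rewrite exprS; apply: lauM.
Qed.

Lemma lau_ev c P z : c != Some true -> lau c z -> lau c (ev P z).
Proof.
move=> c1 zc; elim/poly_ind: P => [|P k IHP].
  by rewrite ev0 -[0]/(0%:~R); apply: lau_int.
rewrite evD evM evX evC; apply: lauD; last exact: lau_int.
by have := lauM IHP zc; case: (c) c1 => [[]|].
Qed.

Lemma lau_xif : lau None (xif *+ 2).
Proof.
have D0 := lauW lau_D; have Di0 := lauW lau_Di.
have lau1 k : lau None k%:~R by apply: lau_int.
rewrite xif_D expr2; apply: (@lauM None None); last exact: (lauM Di0 Di0).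
apply: (@lauM None None); first exact: (lauD (lau1 1) D0).
by apply: (@lauD None); [apply/lauW/(lau_double true) | exact: (lau1 (-1))].
Qed.

(** * Traces for D -> 1 / D and the two steps *)

Lemma trace_odd g : lau None g -> exists T,
  (D - 1) * g + (Di - 1) * sgn g = (y - 4%:R) * ev T y.
Proof.
(* By linearity over [Z[y]]: the trace is [y - 4] for [g = 1] and [(y - 1) (y - 4)] for [g = D]. *)
case=> u [v [-> _]]; exists (u + ('X - 1) * v).
rewrite (rmorphD sgn) (rmorphM sgn) /= sgn_D !ev_y !sgn_V2 -!ev_y !evE yE.
by ring: D_Di.
Qed.

(* [T] is the quotient of [D ^+ 2 * g - sgn g] by [D ^+ 2 - 1]. *)
Definition trace_even g T :=
  (D ^+ 2 - 1) * g + (Di ^+ 2 - 1) * sgn g = y * (y - 4%:R) * ev T y.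

Lemma trace_evenP c g : lau c g -> exists2 T : {poly int},
  trace_even g T & (c == Some true -> 2 %| T`_0)%Z.
Proof.
(* Here [1] and [D] give [y (y - 4)] and [(y - 2) y (y - 4)]. The constant coefficient [u_0 - 2 v_0]
   is even as soon as [u_0] is. *)
case=> u [v [-> uv]]; exists (u + ('X - 2%:P) * v).
  rewrite /trace_even (rmorphD sgn) (rmorphM sgn) /= sgn_D !ev_y !sgn_V2 -!ev_y !evE yE.
  by ring: D_Di.
move=> /eqP c1; rewrite c1 in uv; rewrite coefD coef0M coefB coefX coefC.
by apply: rpredD => //; apply: dvdz_mulr.
Qed.

Lemma y_sub4 : y - 4%:R = (V 2 xif - 1) * 4%:R.
Proof. by rewrite y.unlock; ring. Qed.

(** [y (y - 4)] is [16 xi(q^2) (xi(q^2) - 1)], and [U] halves the trace. *)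
Lemma U_trace_even h f g T : trace_even g T ->
  f = V 2 xif ^+ h * ((D ^+ 2 - 1) * g) ->
  U f = xif ^+ h.+1 * ((xif - 1) * ev T (xif *+ 4)) * 8%:R.
Proof.
move=> gT ->; apply: U_eq.
rewrite !(rmorphM (V 2)) (rmorphXn (V 2)) (rmorphB (V 2)) (rmorph_nat (V 2)) (rmorph1 (V 2)) /= -ev_y.
rewrite (rmorphM sgn) (rmorphM sgn) (rmorphXn sgn) (rmorphB sgn) (rmorphXn sgn) (rmorph1 sgn) /=.
rewrite sgn_V2 sgn_D -mulrDr gT y_sub4 y.unlock exprSr; ring.
Qed.

Lemma xif_X t : xif ^+ t = sig ^+ t * (D *+ 2 - 1) ^+ t * (Di ^+ 2) ^+ t.
Proof. by rewrite xif_sig (exprMn t) (exprMn t). Qed.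

Lemma V2_xif_X h : V 2 xif ^+ h = sig ^+ (2 * h) * Di ^+ h.
Proof. by rewrite exprM sig_sqr exprMn -mulrA -exprMn D_Di expr1n mulr1. Qed.

Lemma U_step_odd n t h P : (n + t = 2 * h)%N -> exists T,
  U (sig ^+ n * (xif ^+ t * ((xif - 1) * ev P (xif *+ 2)))) =
  xif ^+ h * ((xif - 1) * ev T (xif *+ 4)).
Proof.
move=> nt.
(* What remains once [xi(q^2)^h] and [D - 1] are taken out: [D^h] comes from [sig^(2h)], and
   [Di ^+ 2] occurs [t] times from [xi^t] and once from [xi - 1]. *)
pose g := D ^+ h * (Di ^+ 2) ^+ t.+1 * (D *+ 2 - 1) ^+ t * ev P (xif *+ 2).
have [T gT] : exists T, (D - 1) * g + (Di - 1) * sgn g = (y - 4%:R) * ev T y.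
  have lX z m : lau None z -> lau None (z ^+ m).
    move=> z0; elim: m => [|m IHm]; last by rewrite exprS; apply: (lauM z0 IHm).
    by rewrite expr0; apply: (@lau_int None 1).
  apply: trace_odd; have D0 := lauW lau_D; have Di0 := lauW lau_Di.
  apply: (@lauM None None); last by apply: lau_ev => //; apply: lau_xif.
  apply: (@lauM None None); last first.
    apply: lX; apply: (@lauD None); first exact/lauW/(lau_double true).
    exact: (@lau_int None (-1)).
  by apply: (@lauM None None); [apply: lX | apply/lX/lX].
exists T; apply: U_eq; apply: (@fps_mulIn 1).
have -> : (sig ^+ n * (xif ^+ t * ((xif - 1) * ev P (xif *+ 2))) +
   sgn (sig ^+ n * (xif ^+ t * ((xif - 1) * ev P (xif *+ 2))))) *+ 2 =
   V 2 xif ^+ h * ((D - 1) * g) + sgn (V 2 xif ^+ h * ((D - 1) * g)).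
  have <- : sig ^+ n * (xif ^+ t * ((xif - 1) * ev P (xif *+ 2))) *+ 2 =
      V 2 xif ^+ h * ((D - 1) * g).
    have -> : sig ^+ n * (xif ^+ t * ((xif - 1) * ev P (xif *+ 2))) *+ 2 =
      sig ^+ n * (xif ^+ t * (((xif - 1) *+ 2) * ev P (xif *+ 2))) by ring.
    rewrite xif1_D xif_X /g.
    have -> : V 2 xif ^+ h = sig ^+ n * sig ^+ t * Di ^+ h by rewrite V2_xif_X -nt exprD.
    have DDh : D ^+ h * Di ^+ h = 1 by rewrite -exprMn D_Di expr1n.
    move: (ev _ _) => r; rewrite [_ ^+ t.+1]exprS.
    move: (sig ^+ n) (sig ^+ t) ((D *+ 2 - 1) ^+ t) ((Di ^+ 2) ^+ t) => a b c d.
    transitivity (a * b * (D ^+ h * Di ^+ h) * (D - 1) * Di ^+ 2 * d * c * r); last by ring.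
    by rewrite DDh; ring.
  by rewrite (rmorphMn sgn) mulrnDl.
rewrite !(rmorphM (V 2)) (rmorphXn (V 2)) (rmorphB (V 2)) (rmorph1 (V 2)) /= -ev_y.
rewrite (rmorphM sgn) (rmorphM sgn) (rmorphXn sgn) (rmorphB sgn) (rmorph1 sgn) /=.
by rewrite sgn_V2 sgn_D -mulrDr gT y_sub4; ring.
Qed.

Lemma halve_ev (T : {poly int}) z : (2 %| T`_0)%Z -> exists T', ev T (z *+ 2) = ev T' z *+ 2.
Proof.
elim/poly_ind: T => [|T c _]; first by exists 0; rewrite !ev0 mul0rn.
rewrite coefD coefMX coefC /= add0r => /dvdzP[k ->].
exists (dbl T * 'X + k%:P).
by rewrite !evE ev_dbl intrM; ring.
Qed.

Lemma U_step_even n t h P : (n + t = 2 * h + 1)%N -> odd h -> exists T,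
  U (sig ^+ n * (xif ^+ t * ((xif - 1) * ev P (xif *+ 4)))) =
  xif ^+ h.+1 * ((xif - 1) * ev T (xif *+ 2)) * 4%:R.
Proof.
move=> nt oddh.
pose g := D ^+ h * (Di ^+ 2) ^+ t.+1 * (D *+ 2 - 1) ^+ t * ev P (xif *+ 2 *+ 2).
(* The one factor of odd grade is [D^h], as [h] is odd: [1 / D] enters to an even power, [2 D - 1]
   is a constant modulo 2, and [4 xi] is twice an element of [Z[D, 1/D]]. *)
have lg : lau (Some true) g.
  apply: (@lauM (Some true) (Some false)); last by apply: lau_ev => //; apply/lau_double/lau_xif.
  apply: (@lauM (Some true) (Some false)); last first.
    rewrite -[false]/(false && odd t); apply: lauX.
    by apply: lauD; [exact/lau_double/lauW/lau_D | exact: (@lau_int (Some false) (-1))].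
  apply: (@lauM (Some true) (Some false)).
    by have := lauX h lau_D; rewrite oddh.
  by have := lauX t.+1 (lauX 2 lau_Di).
have [T gT /(_ isT) T0] := trace_evenP lg.
have [T' T'E] := halve_ev (xif *+ 2) T0.
exists T'.
(* The 4 clears the denominators of [xi - 1] and of the leftover [sig]. With the 8 of [U_trace_even]
   and the 2 of [halve_ev], the factor gained is [8 * 2 / 4]. *)
apply: (@fps_mulIn 3).
have -> : U (sig ^+ n * (xif ^+ t * ((xif - 1) * ev P (xif *+ 4)))) *+ 4 =
  U (sig ^+ n * (xif ^+ t * ((xif - 1) * ev P (xif *+ 4))) *+ 4).
  by apply: fps_eqP => m; rewrite fpsMn /U fpsMn.
rewrite (U_trace_even (h := h) gT).
  have -> : xif *+ 4 = xif *+ 2 *+ 2 by rewrite -mulrnA.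
  by rewrite T'E; ring.
have -> : sig ^+ n * (xif ^+ t * ((xif - 1) * ev P (xif *+ 4))) *+ 4 =
   sig ^+ n * (xif ^+ t * (((xif - 1) *+ 2) * ev P (xif *+ 4))) *+ 2 by ring.
rewrite xif1_D xif_X /g -[xif *+ 2 *+ 2]mulrnA -[(2 * 2)%N]/4%N.
have V2h : V 2 xif ^+ h * (1 + D) = sig ^+ n * sig ^+ t * Di ^+ h *+ 2.
  by rewrite V2_xif_X -exprD nt exprD expr1 -sigf; ring.
have DDh : D ^+ h * Di ^+ h = 1 by rewrite -exprMn D_Di expr1n.
move: (ev _ _) => r; rewrite [_ ^+ t.+1]exprS.
transitivity ((V 2 xif ^+ h * (1 + D)) * D ^+ h * (D - 1) * Di ^+ 2 * (Di ^+ 2) ^+ t *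
   (D *+ 2 - 1) ^+ t * r); last by ring.
rewrite V2h; move: (sig ^+ n) (sig ^+ t) ((D *+ 2 - 1) ^+ t) ((Di ^+ 2) ^+ t) => a b c d.
transitivity (a * b * (D ^+ h * Di ^+ h) * (D - 1) * Di ^+ 2 * d * c * r *+ 2); last by ring.
by rewrite DDh; ring.
Qed.

(** The trace quotient of [(2 D - 1) / D^3] is [y - 4]; multiplication by the invariant [y] makes it
    [y (y - 4)]. *)
Lemma lau_rem g : (exists2 g', lau None g' & g = y * ((D *+ 2 - 1) * Di ^+ 3) + 4%:R * g') ->
  exists T, trace_even g ('X * ('X - 4%:P) + 4%:P * T).
Proof.
case=> g' /trace_evenP[T g'T _] ->; exists T; move: g'T; rewrite /trace_even => g'T.
have ev4 : ev 4%:P y = 4%:R by rewrite evC.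
rewrite !(evD, evM, evN, evX) ev4.
rewrite !sgnE /= sgn_D sgn_Di sgn_y.
transitivity (y * ((D ^+ 2 - 1) * ((D *+ 2 - 1) * Di ^+ 3) +
   (Di ^+ 2 - 1) * ((Di *+ 2 - 1) * D ^+ 3)) +
   4%:R * ((D ^+ 2 - 1) * g' + (Di ^+ 2 - 1) * sgn g')); first by ring.
rewrite g'T.
have -> : (D ^+ 2 - 1) * ((D *+ 2 - 1) * Di ^+ 3) + (Di ^+ 2 - 1) * ((Di *+ 2 - 1) * D ^+ 3) =
  y * (y - 4%:R) * (y - 4%:R) by rewrite yE; ring: D_Di.
by ring.
Qed.

(* Here 2 D - 1 has square 1 + 4 m, so its seventh power is 2 D - 1 modulo 4. *)
Lemma h2_mod4 : exists2 g', lau None g' &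
  Di ^+ 2 * (D *+ 2 - 1) ^+ 7 * h2 Di = y * ((D *+ 2 - 1) * Di ^+ 3) + 4%:R * g'.
Proof.
pose m := D ^+ 2 - D.
pose s := ev ('X * (10%:P + 'X * (48%:P - 'X * (56%:P - 'X * (18%:P - 'X * (4%:P + 'X *
  (28%:P - 'X * (48%:P - 'X * (32%:P - 'X * 8%:P))))))))) Di.
have sE : h2 Di = (1 + Di) ^+ 2 + 4%:R * s.
  rewrite /h2 /s !(evD, evM, evN, evX, evC); ring.
exists (Di ^+ 2 * ((D *+ 2 - 1) * (3%:R * m + 12%:R * m ^+ 2 + 16%:R * m ^+ 3) * h2 Di
  + (D *+ 2 - 1) * s)); last first.
  rewrite sE yE /m; move: s sE => s _.
  by ring: D_Di.
have M g g' : lau None g -> lau None g' -> lau None (g * g') by apply: (@lauM None None).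
have D0 := lauW lau_D; have Di0 := lauW lau_Di.
have n0 (k : nat) : lau None k%:R by apply: (@lau_int None k).
have N g : lau None g -> lau None (- g).
  by move=> lg; rewrite -mulN1r; apply: (M) => //; apply: (@lau_int None (-1)).
have A g g' : lau None g -> lau None g' -> lau None (g + g') by apply: (@lauD None).
have X g k : lau None g -> lau None (g ^+ k).
  by move=> lg; elim: k => [|k IHk]; [apply: (n0 1%N) | rewrite exprS; apply: (M)].
have s0 : lau None s by apply: lau_ev.
have m0 : lau None m by apply: (A); [apply: (X) | apply: (N)].
have D1 : lau None (D *+ 2 - 1) by apply: (A); [exact/lauW/(lau_double true) | exact: (N _ (n0 1%N))].
have h0 : lau None (h2 Di).
  rewrite sE; apply: (A); last exact: (M).
  by apply: (X); apply: (A) => //; exact: (n0 1%N).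
apply: (M); first exact: (X).
apply: (A); last exact: (M).
apply: (M) => //; apply: (M) => //.
by apply: (A); [apply: (A)|]; apply: (M) => //; apply: (X).
Qed.

Lemma Delta3 : exists P,
  Delta 3 = 2%:R ^+ 5 * (xif ^+ 14 * ((xif - 1) * ev P (xif *+ 2))).
Proof.
have [T gT] := lau_rem h2_mod4.
(* At [4 xi], [X (X - 4) + 4 T] is 4 times this witness at [2 xi]; with the 8 of [U_trace_even] this
   makes [2^5]. *)
exists ('X ^+ 2 - 2%:P * 'X + dbl T).
rewrite Delta_S -[(5 * 2 ^ 2)%N]/20%N.
rewrite (U_trace_even (h := 13) gT); last first.
  rewrite Delta2 xif_X.
  rewrite V2_xif_X -[(2 * 13)%N]/26%N.
  move: (h2 Di) => r.
  (* Of the 27 factors [sig], 26 form [xi(q^2)^13] up to a power of [D], and the last one is doubled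
     into [1 + D]. *)
  transitivity (sig ^+ 26 * (sig *+ 2) * (D *+ 2 - 1) ^+ 7 * Di ^+ 14 * (1 - Di) * r).
    by ring.
  by rewrite sigf; ring: D_Di.
have ev4 : ev 4%:P (xif *+ 4) = 4%:R by rewrite evC.
rewrite !(evD, evM, evN, evX, evXn) ev4 ev_dbl evC2 -mulrnA -[(2 * 2)%N]/4%N.
by ring.
Qed.

Lemma U_nat m f : U (2%:R ^+ m * f) = 2%:R ^+ m * U f.
Proof.
by rewrite -{1}(rmorph_nat (V 2)) -(rmorphXn (V 2)) U_V2M.
Qed.

(* The exponent [40 s + 14] is [tau (K + 1)]. *)
Lemma Delta_odd K : exists s P, (4 ^ K = 3 * s + 1)%N /\
  Delta (2 * K + 3) =
  2%:R ^+ (2 * K + 5) * (xif ^+ (40 * s + 14) * ((xif - 1) * ev P (xif *+ 2))).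
Proof.
elim: K => [|K [s [P [sE PE]]]].
  by have [P PE] := Delta3; exists 0%N, P.
have e1 : (5 * 2 ^ (2 * K + 3) = 120 * s + 40)%N.
  by rewrite expnD expnM -[(2 ^ 2)%N]/4%N sE; lia.
have e2 : (5 * 2 ^ (2 * K + 4) = 240 * s + 80)%N.
  by rewrite expnD expnM -[(2 ^ 2)%N]/4%N sE; lia.
have -> : (2 * K.+1 + 3 = (2 * K + 4).+1)%N by lia.
have odd1 : (5 * 2 ^ (2 * K + 3) + (40 * s + 14) = 2 * (80 * s + 27))%N by lia.
have [T TE] := U_step_odd P odd1.
have even1 : (5 * 2 ^ (2 * K + 4) + (80 * s + 27) = 2 * (160 * s + 53) + 1)%N by lia.
have oddh : odd (160 * s + 53) by rewrite oddD oddM.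
have [T' T'E] := U_step_even T even1 oddh.
(* From [4 (3 s + 1) = 3 (4 s + 1) + 1]. *)
exists (4 * s + 1)%N, T'; split; first by rewrite expnS sE; lia.
rewrite Delta_S -{2}[(2 * K + 4)%N]/(2 * K + 4)%N.
have -> : Delta (2 * K + 4) = 2%:R ^+ (2 * K + 5) * (xif ^+ (80 * s + 27) *
    ((xif - 1) * ev T (xif *+ 4))).
  have -> : (2 * K + 4 = (2 * K + 3).+1)%N by lia.
  by rewrite Delta_S PE mulrCA U_nat TE.
rewrite mulrCA U_nat T'E.
have -> : (40 * (4 * s + 1) + 14 = (160 * s + 53).+1)%N by lia.
have -> : (2 * K.+1 + 5 = 2 * K + 5 + 2)%N by lia.
by rewrite [2%:R ^+ (_ + 2)]exprD; ring.
Qed.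

(** * Identification of the coefficients *)

Lemma GE k n : G k n = PDO (2 ^ k * n).
Proof.
elim: k n => [|k IHk] n; first by rewrite /G /= G0.unlock mul1n.
by rewrite -[LHS]/(G k (2 * n)%N) IHk expnSr mulnA.
Qed.

Lemma PhiE k : (Phi k : fps) = Delta k.
Proof.
rewrite /Phi /Delta spowE gam.unlock; congr (_ * _ : fps).
by apply: fps_eqP => n; rewrite fpsB !GE.
Qed.

Lemma poly_at_xiE P : (poly_at_xi P : fps) = ev P xif.
Proof.
apply: fps_eqP => n; rewrite /ev.
rewrite (@horner_coef_wide _ (size P)); last exact: size_poly.
rewrite fps_sum /poly_at_xi; apply: eq_bigr => i _.
by rewrite coef_map_id0 // fpsMz spowE xif.unlock.
Qed.

(** [xi - 1] is non-zero with constant term 0, so after a shift by 1 the coefficients of a relation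
    are peeled off one by one. This is the uniqueness of the [F_k(m)]. *)
Lemma ev_inj P Q : ev P xif = ev Q xif -> P = Q.
Proof.
move=> PQ; apply/eqP; rewrite -subr_eq0; apply/eqP.
have : ev ((P - Q) \Po ('X + 1%:P)) (xif - 1) = 0.
  by rewrite ev_comp [ev ('X + _) _]evD evX evC subrK evD evN PQ subrr.
have t0 : xif - 1 != 0.
  apply/eqP => /(congr1 (fun f : fps => f 1%N)).
  by rewrite fpsB xifE eta_coef1 fps1.
have inj R : ev R (xif - 1) = 0 -> R = 0.
  elim/poly_ind: R => // R c IHR; rewrite evD evM evX evC => Rc.
  have c0 : c = 0.
    have := congr1 (fun f : fps => f 0%N) Rc.
    rewrite fpsD fpsM0 fpsB xifE eta_const fps1 subrr mulr0 add0r.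
    by rewrite -[_%:~R]mulr1 fpsMz fps1 mulr1.
  move: Rc; rewrite c0 addr0 => /eqP; rewrite mulf_eq0 (negPf t0) orbF => /eqP/IHR ->.
  by rewrite mul0r add0r polyC0.
move=> /inj/(congr1 (fun R => R \Po ('X - 1%:P))).
by rewrite comp_polyXaddC_K comp_poly0.
Qed.

Lemma tau_E K s : (4 ^ K = 3 * s + 1)%N -> tau K.+1 = (40 * s + 14)%N.
Proof.
move=> sE; rewrite /tau.
have -> : (2 * K.+1 - 1 = 2 * K + 1)%N by lia.
have -> : (K.+1 - 1 = K)%N by lia.
have -> : (2 * (4 ^ K - 1) %/ 3 = 2 * s)%N by rewrite sE addnK mulnCA mulKn.
by rewrite expnD expnM -[(2 ^ 2)%N]/4%N sE; lia.
Qed.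

Unset Implicit Arguments.

(* F_{2K+1}(m) is the m-th coefficient of the (unique) integer polynomial P
   with Phi_{2K+1} = P(xi) as formal power series. *)
Theorem theorem6p1 :
  forall (K : nat), (2 <= K)%N ->
  forall (P : {poly int}),
    (forall n : nat, Phi (2 * K + 1) n = poly_at_xi P n) ->
    nu_ge P`_(tau K) (2 * K + 3) /\
    (forall M : nat, (1 <= M)%N -> nu_ge P`_(tau K + M) (2 * K + M + 2)).
Proof.
case=> // K _ P PE.
(* From here on [K] is one less than in the statement, which is the indexing of [Delta_odd]. *)
have [s [R [sE RE]]] := Delta_odd K.
pose t := (40 * s + 14)%N.
have PQ : P = (2 ^+ (2 * K + 5))%:P * ('X^t * (('X - 1) * dbl R)).
  apply: ev_inj; rewrite -poly_at_xiE -(fps_eqP PE) PhiE.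
  have -> : (2 * K.+1 + 1 = 2 * K + 3)%N by lia.
  by rewrite RE !evE ev_dbl rmorphXn.
have coefP i : P`_(t + i) = 2 ^+ (2 * K + 5) * ((('X - 1) * dbl R)`_i).
  by rewrite PQ coefCM coefXnM ltnNge leq_addr addKn.
have nuX (a b : nat) (c : int) : (a <= b)%N -> nu_ge (2 ^+ b * c) a.
  move=> leab; rewrite /nu_ge; apply: dvdz_mulr.
  by rewrite -(subnKC leab) exprD; apply: dvdz_mulr; rewrite -natrX natz.
rewrite (tau_E sE) -/t; split.
  by rewrite -[t in P`_t]addn0 coefP; apply: nuX; lia.
(* Multiplication by [X - 1] mixes two consecutive coefficients of [R(2 X)], and the lower one only
   carries [2 ^+ M], where [M] is now one less than in the statement. *)
case=> // M _; rewrite coefP mulrBl mul1r coefB coefXM /= !coef_dbl.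
have -> : 2 ^+ (2 * K + 5) * (R`_M * 2 ^+ M - R`_M.+1 * 2 ^+ M.+1) =
  2 ^+ (2 * K + 5 + M) * (R`_M - R`_M.+1 * 2) :> int.
  by rewrite (exprD _ (2 * K + 5) M) [_ ^+ M.+1]exprS; ring.
by apply: nuX; lia.
Qed.
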